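(* Let $n\ge0$ be an integer, let $u_1,\ldots,u_{n+1}$ be indeterminates, and write $\bar{u}=u^{-1}$. Let $\lambda=(n,n-1,n-1,\ldots,2,2,1,1)$. Then the odd-order DASASM partition function at $q=e^{i\pi/6}$ is $$Z(u_1,\ldots,u_{n+1})\big|_{q=e^{i\pi/6}}=3^{-n(n-1)/2}\left(\frac{u_{n+1}^n}{u_{n+1}+1}\,s_{\lambda}(u_1^2,\bar{u}_1^2,\ldots,u_n^2,\bar{u}_n^2,\bar{u}_{n+1}^2)+\frac{\bar{u}_{n+1}^n}{\bar{u}_{n+1}+1}\,s_{\lambda}(u_1^2,\bar{u}_1^2,\ldots,u_n^2,\bar{u}_n^2,u_{n+1}^2)\right).$$
   Context: $s_\lambda(x_1,\ldots,x_k)$ denotes the Schur polynomial indexed by the partition $\lambda$. The partition $(n,n-1,n-1,\ldots,2,2,1,1)$ has the part $n$ once and each of the parts $n-1,n-2,\ldots,1$ exactly twice (it is $(1)$ for $n=1$ and empty for $n=0$). Notation: $\bar{x}=x^{-1}$ and $\sigma(x)=x-x^{-1}$. The parameter $q$ is fixed and suppressed from the notation. The graph $\mathcal{T}_n$ ($n\ge0$). Its vertices are: top vertices $(0,j)$ for $1\le j\le 2n+1$; vertices $(i,j)$ for $1\le i\le n$ and $i\le j\le 2n+2-i$; and a bottom vertex $(n+1,n+1)$. Vertex $(i,j)$ is drawn in row $i$ (rows numbered downward) and column $j$ (numbered rightward). Its edges are the horizontal edges between $(i,j)$ and $(i,j+1)$ for $1\le i\le n$, $i\le j\le 2n+1-i$,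 and the vertical edges between $(i-1,j)$ and $(i,j)$ for $1\le i\le n+1$, $i\le j\le 2n+2-i$. The vertices $(i,i)$ ($1\le i\le n$, degree 2, incident edges above and to the right) are left boundary vertices; $(i,2n+2-i)$ ($1\le i\le n$, degree 2, incident edges above and to the left) are right boundary vertices; $(i,j)$ with $1\le i\le n$, $i<j<2n+2-i$ (degree 4) are bulk vertices. A six-vertex configuration $C$ on $\mathcal{T}_n$ is an orientation of all edges of $\mathcal{T}_n$ such that each edge incident to a top vertex is directed upward (into the top vertex), and at each bulk vertex exactly two incident edges are directed in and two are directed out. $C_{ij}$ denotes the local configuration (orientations of the edges incident to $(i,j)$). Weights $W(c,u)$ of a local configuration $c$ with parameter $u$: - Bulk vertex: $W(c,u)=1$ if both horizontal edges point into the vertex (and both vertical edges out), or both horizontal edges point out (and both vertical edges in); $W(c,u)=\sigma(q^2u)/\sigma(q^4)$ if both vertical edges point up and both horizontal edges point right, or both vertical edges point down and both horizontal edges point left; $W(c,u)=\sigma(q^2\bar{u})/\sigma(q^4)$ if both vertical edges point up and both horizontal edges point left, or both vertical edges point down and both horizontal edges point right. - Left boundary vertex: $W(c,u)=1$ if one of the two incident edges points in and the other out; $W(c,u)=\sigma(qu)/\sigma(q)$ if both point in or both point out. - Right boundary vertex: $W(c,u)=1$ if one of the two incident edges points in and the other out; $W(c,u)=\sigma(q\bar{u})/\sigma(q)$ if both point in or both point out. The odd-order DASASM partition function is $$Z(u_1,\ldots,u_{n+1})=\sum_{C}\prod_{i=1}^n W(C_{ii},u_i)\left(\prod_{j=i+1}^{2n+1-i}W(C_{ij},u_i\,u_{\min(j,2n+2-j)})\right)W(C_{i,2n+2-i},u_i),$$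 summed over all six-vertex configurations $C$ on $\mathcal{T}_n$ (so $Z(u_1)=1$ for $n=0$). *)

(* Defs.v *)
From HB Require Import structures.
From mathcomp Require Import all_boot all_order all_algebra.
From mathcomp Require Import complex.
From mathcomp Require Import reals trigo.
From mathcomp Require Import mpoly.

Set Implicit Arguments.
Unset Strict Implicit.
Unset Printing Implicit Defensive.

Import Order.TTheory GRing.Theory Num.Theory.
Local Open Scope ring_scope.

Section Graph.
Variable n : nat.

(* The grid [0, n+1] x [0, 2n+1] containing the vertices (i, j) of T_n (row i,
   column j).  The grid points that are not vertices of T_n, such as those of
   column 0, are isolated. *)
Definition grid := ('I_n.+2 * 'I_n.*2.+2)%type.

(* Meaningful for i <= n + 1 and j <= 2n + 1. *)
Definition vtx (i j : nat) : grid := (inord i, inord j).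

(* There is a horizontal edge (i, j) -- (i, j + 1). *)
Definition has_hedge (i j : nat) : bool :=
  [&& (1 <= i <= n)%N, (i <= j)%N & (j <= n.*2.+1 - i)%N].

(* There is a vertical edge (i - 1, j) -- (i, j). *)
Definition has_vedge (i j : nat) : bool :=
  [&& (1 <= i <= n.+1)%N, (i <= j)%N & (j <= n.*2.+2 - i)%N].

(* w is the neighbour of v to its right. *)
Definition right_nbr (v w : grid) : bool :=
  [&& v.1 == w.1, (w.2 == v.2.+1 :> nat) & has_hedge v.1 v.2].

(* w is the neighbour of v below it. *)
Definition below_nbr (v w : grid) : bool :=
  [&& v.2 == w.2, (w.1 == v.1.+1 :> nat) & has_vedge w.1 w.2].

Definition adj (v w : grid) : bool :=
  [|| right_nbr v w, right_nbr w v, below_nbr v w | below_nbr w v].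

Definition is_bulk (i j : nat) : bool :=
  [&& (1 <= i <= n)%N, (i < j)%N & (j < n.*2.+2 - i)%N].

(* (v, w) \in C means that the edge between v and w is directed from v to w. *)
Definition is_orientation (C : {set grid * grid}) : bool :=
  [forall v, forall w,
    if adj v w then ((v, w) \in C) (+) ((w, v) \in C) else (v, w) \notin C].

Definition indeg (C : {set grid * grid}) (v : grid) : nat :=
  #|[set w | (w, v) \in C]|.

Definition outdeg (C : {set grid * grid}) (v : grid) : nat :=
  #|[set w | (v, w) \in C]|.

Definition six_vertex (C : {set grid * grid}) : bool :=
  [&& is_orientation C,
      [forall j : 'I_n.*2.+2,
        (1 <= j <= n.*2.+1)%N ==> ((vtx 1 j, vtx 0 j) \in C)]
    & [forall v : grid,
        is_bulk v.1 v.2 ==> (indeg C v == 2%N) && (outdeg C v == 2%N)]].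

Definition arc (C : {set grid * grid}) (i j i' j' : nat) : bool :=
  (vtx i j, vtx i' j') \in C.

End Graph.

Section PartitionFunction.
Variable F : fieldType.
Variable q : F.

Definition sigma (x : F) : F := x - x^-1.

(* The local configuration is given by the directions of its edges: l and r
   tell whether the left and right edges point right, t and b whether the top
   and bottom edges point up. *)
Definition bulk_weight (l r t b : bool) (u : F) : F :=
  if [&& l, ~~ r, t & ~~ b] || [&& ~~ l, r, ~~ t & b] then 1
  else if [&& t, b, r & l] || [&& ~~ t, ~~ b, ~~ r & ~~ l] then
    sigma (q ^+ 2 * u) / sigma (q ^+ 4)
  else if [&& t, b, ~~ r & ~~ l] || [&& ~~ t, ~~ b, r & l] then
    sigma (q ^+ 2 * u^-1) / sigma (q ^+ 4)
  else 0. (* excluded by the six-vertex condition *)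

(* o1 and o2 tell whether the two edges point out of the vertex. *)
Definition left_weight (o1 o2 : bool) (u : F) : F :=
  if o1 == o2 then sigma (q * u) / sigma q else 1.

Definition right_weight (o1 o2 : bool) (u : F) : F :=
  if o1 == o2 then sigma (q * u^-1) / sigma q else 1.

Section Config.
Variables (n : nat) (C : {set grid n * grid n}).

Definition W_bulk (i j : nat) : F -> F :=
  bulk_weight (arc C i j.-1 i j) (arc C i j i j.+1)
              (arc C i j i.-1 j) (arc C i.+1 j i j).

(* Weight of the left boundary vertex (i, i). *)
Definition W_left (i : nat) : F -> F :=
  left_weight (arc C i i i.-1 i) (arc C i i i i.+1).

(* Weight of the right boundary vertex (i, 2n + 2 - i). *)
Definition W_right (i : nat) : F -> F :=
  let j := (n.*2.+2 - i)%N in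
  right_weight (arc C i j i.-1 j) (arc C i j i j.-1).

End Config.

(* Only u 1, ..., u n.+1 matter. *)
Definition Z (n : nat) (u : nat -> F) : F :=
  \sum_(C : {set grid n * grid n} | six_vertex C)
    \prod_(1 <= i < n.+1)
      (W_left C i (u i) *
       (\prod_(i.+1 <= j < n.*2.+2 - i)
          W_bulk C i j (u i * u (minn j (n.*2.+2 - j)))) *
       W_right C i (u i)).

(* The alternant det (x_i ^ a_j). *)
Definition alternant (k : nat) (a : 'I_k -> nat) (x : 'I_k -> F) : F :=
  \det (\matrix_(i < k, j < k) x i ^+ a j).

(* Value of the Schur polynomial s_lam (x_1, ..., x_k) at pairwise distinct
   elements of a field, for a partition lam with at most k parts, as the
   quotient of alternants with exponents lam_j + k - j and k - j (1 <= j <= k;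
   the index j of the code starts at 0). *)
Definition schur (lam : seq nat) (k : nat) (x : 'I_k -> F) : F :=
  alternant (fun j : 'I_k => (nth 0 lam j + (k - j.+1))%N) x
  / alternant (fun j : 'I_k => (k - j.+1)%N) x.

(* (u_1^2, u_1^-2, ..., u_n^2, u_n^-2, w) *)
Definition schur_args (n : nat) (u : nat -> F) (w : F) (i : 'I_n.*2.+1) : F :=
  (rcons (flatten [seq [:: u m ^+ 2; u m ^- 2] | m <- iota 1 n]) w)`_i.

End PartitionFunction.

(* (n, n-1, n-1, ..., 2, 2, 1, 1) *)
Definition lambda (n : nat) : seq nat :=
  if n is m.+1 then n :: flatten [seq [:: p; p] | p <- rev (iota 1 m)]
  else [::].

Section Indeterminates.
Variables (R : realType) (n : nat).

(* The field of rational functions in u_1, ..., u_{n+1} over the complex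
   numbers R[i]. *)
Definition ratfun := {fraction {mpoly (R[i])%C[n.+1]}}.

Definition constf (c : (R[i])%C) : ratfun :=
  tofrac (c%:MP : {mpoly (R[i])%C[n.+1]}).

(* The indeterminate u_m, for 1 <= m <= n + 1; 'X_i is numbered from 0. *)
Definition indet (m : nat) : ratfun :=
  tofrac ('X_(inord m.-1 : 'I_n.+1) : {mpoly (R[i])%C[n.+1]}).

End Indeterminates.

(* exp (i pi / 6) *)
Definition exp_ipi6 (R : realType) : (R[i])%C :=
  (cos (pi / 6%:R : R) +i* sin (pi / 6%:R : R))%C.

(* Main.v *)
Require Import Defs.
From mathcomp Require Import all_boot all_order all_algebra.
From mathcomp Require Import complex reals.
From mathcomp Require Import fingroup perm trigo mpoly ring zify lra.

(* The rows of the triangle are transfer operators on words of vertical edges.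
   Their weights satisfy the Yang-Baxter equation and the left and right
   reflection equations, so Z is symmetric in u_1, ..., u_n.  It is also even in
   u_1, invariant under the simultaneous inversion of all the parameters, and
   u_{n+1}^n Z is a polynomial of degree at most 2n in u_{n+1}.

   At u_1 u_{n+1} = q^2 the vertex at the crossing of row 1 and the central
   column splits into two strands.  The left half of row 1 is then frozen, and
   the line made of the central column and of the right half of row 1 can be
   pulled through the right boundary until it lies below all the others.  What
   is left is the partition function of order n - 1 at (u_2, ..., u_n, u_1).

   Let q = exp (i pi / 6), so that w = q^4 is a cube root of unity.  The alternant
   in the numerator of s_lambda has the exponents in [0, 3n] congruent to 0 or 1
   modulo 3, hence s_lambda (x_1, ..., x_{2n-1}, y, w y) is the product of the
   x_i - w^2 y times the polynomial of order n - 1 at (x_1, ..., x_{2n-1}).  So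
   the right-hand side satisfies the same recursion.  Multiplied by u_{n+1} + 1
   and by the Vandermonde determinant, both sides become, up to a power of
   v = u_{n+1}, polynomials of degree at most 6n + 1 in v which agree at the 8n
   points v = +-u_i, +-1/u_i (where both vanish) and +-q^2/u_i, +-q^(-2)/u_i. *)

Set Implicit Arguments.
Unset Strict Implicit.
Unset Printing Implicit Defensive.

Import Order.TTheory GRing.Theory Num.Theory.
Local Open Scope ring_scope.

Local Ltac size_lia := repeat progress rewrite ?size_cat ?size_rev ?size_rcons /=; lia.

(** * Rows of vertices as transfer operators on words *)

Section Rows.
Variable F : fieldType.
Implicit Types (f g : bitseq -> F) (w ts : bitseq).

Lemma sum_bool (f : bool -> F) : \sum_(b : bool) f b = f true + f false.
Proof. by rewrite big_bool. Qed.

Lemma sum_bool2 (f : bool * bool -> F) :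
  \sum_(p : bool * bool) f p =
  f (true, true) + f (true, false) + f (false, true) + f (false, false).
Proof.
rewrite (eq_bigr (fun p => f (p.1, p.2))) => [|[] //].
by rewrite -(pair_bigA _ (fun a b => f (a, b))) /= !big_bool; exact: addrA.
Qed.

(* A site gives the weight of a vertex from its left, right, top and bottom
   edges.  A row of sites S turns a functional f of the word below it into a
   functional of the word above it; l and r are its outer horizontal edges. *)
Definition site := bool -> bool -> bool -> bool -> F.

Fixpoint row (S : seq site) (l r : bool) f ts : F :=
  match S, ts with
  | [::], [::] => if l == r then f [::] else 0
  | s :: S', t :: ts' =>
      \sum_(p : bool * bool) s l p.1 t p.2 * row S' p.1 r (fun bs => f (p.2 :: bs)) ts'
  | _, _ => 0
  end.

Lemma eq_row S l r f g ts :
  (forall bs, size bs = size S -> f bs = g bs) -> row S l r f ts = row S l r g ts.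
Proof.
elim: S l f g ts => [|s S IH] l f g [|t ts] //= h; first by rewrite h.
by apply: eq_bigr => p _; congr (_ * _); apply: IH => bs sz; apply: h; rewrite /= sz.
Qed.

Lemma row_sum (I : finType) S l r (h : I -> bitseq -> F) ts :
  row S l r (fun bs => \sum_i h i bs) ts = \sum_i row S l r (h i) ts.
Proof.
elim: S l h ts => [|s S IH] l h [|t ts] //=; rewrite ?big1_eq //.
  by case: eqP => // _; rewrite big1_eq.
by rewrite exchange_big; apply: eq_bigr => p _; rewrite IH mulr_sumr.
Qed.

Lemma row_scale S l r f (c : F) ts :
  row S l r (fun bs => c * f bs) ts = c * row S l r f ts.
Proof.
elim: S l f ts => [|s S IH] l f [|t ts] //=; rewrite ?mulr0 //.
  by case: eqP; rewrite ?mulr0.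
by rewrite mulr_sumr; apply: eq_bigr => p _; rewrite IH mulrCA.
Qed.

Lemma row0 S l r ts : row S l r (fun=> 0) ts = 0.
Proof. rewrite -[RHS](mul0r (row S l r (fun=> 0) ts)) -row_scale.
by apply: eq_row => *; rewrite mul0r. Qed.

(** A Fubini property: the two rows act on different words, so the order of summation is free. *)
Lemma row_comm S1 l1 r1 S2 l2 r2 (h : bitseq -> bitseq -> F) w1 w2 :
  row S1 l1 r1 (fun a => row S2 l2 r2 (h a) w2) w1 =
  row S2 l2 r2 (fun b => row S1 l1 r1 (h^~ b) w1) w2.
Proof.
elim: S1 l1 h w1 => [|s S IH] l1 h [|t ts] //=; rewrite ?row0 //.
  by case: eqP => // _; rewrite row0.
rewrite row_sum; apply: eq_bigr => p _.
by rewrite (IH p.1 (fun a => h (p.2 :: a))) row_scale.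
Qed.

Lemma row_cat S1 S2 l r f w1 w2 : size w1 = size S1 ->
  row (S1 ++ S2) l r f (w1 ++ w2) =
  \sum_m row S1 l m (fun a => row S2 m r (fun b => f (a ++ b)) w2) w1.
Proof.
elim: S1 l f w1 => [|s S IH] l f [|t ts] //=.
  by move=> _; rewrite (bigD1 l) //= eqxx big1 ?addr0 // => m /negPf; rewrite eq_sym => ->.
move=> [sz]; rewrite exchange_big /=; apply: eq_bigr => p _.
by rewrite IH // mulr_sumr.
Qed.

(** [row] recurses from the left; this peels off its last vertex, as the arguments at the right
    boundary require. *)
Lemma row_rcons S s l r f w t : size w = size S ->
  row (rcons S s) l r f (rcons w t) =
  \sum_(p : bool * bool) s p.1 r t p.2 * row S l p.1 (fun a => f (rcons a p.2)) w.
Proof.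
move=> sz; rewrite -!cats1 row_cat // (eq_bigr (fun m => \sum_(b : bool) s m r t b *
   row S l m (fun a => f (rcons a b)) w)) => [|m _]; first by rewrite pair_bigA.
rewrite -(eq_bigr _ (fun b _ => row_scale _ _ _ _ _ _)) -row_sum.
apply: eq_row => a _ /=.
rewrite (eq_bigr (fun p => if p.1 == r then s m p.1 t p.2 * f (a ++ [:: p.2]) else 0)); last first.
  by move=> p _; case: eqP; rewrite ?mulr0.
rewrite -(pair_bigA _ (fun x y => if x == r then s m x t y * f (a ++ [:: y]) else 0)) /=.
by rewrite (bigD1 r) //= eqxx [X in _ + X]big1 ?addr0 => [|x /negPf->]; rewrite ?big1_eq //;
   apply: eq_bigr => b _; rewrite cats1.
Qed.

(** Train argument: the local exchange relation moves [X] through the two rows one column at a time,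
    from the left end to the right end, and swaps the rows on the way. [l] and [m] are the pairs of
    outer horizontal edges. *)
Lemma train (T : eqType) (X : bool * bool -> bool * bool -> F) (A B : T -> site)
    (cs : seq T) (l m : bool * bool) f ts :
  (forall c (l m : bool * bool) t b, c \in cs ->
    \sum_(p : bool * bool) \sum_(k : bool) X l p * A c p.1 m.1 t k * B c p.2 m.2 k b =
    \sum_(p : bool * bool) \sum_(k : bool) B c l.1 p.1 t k * A c l.2 p.2 k b * X p m) ->
  \sum_(p : bool * bool)
    X l p * row (map A cs) p.1 m.1 (row (map B cs) p.2 m.2 f) ts =
  \sum_(p : bool * bool)
    row (map B cs) l.1 p.1 (row (map A cs) l.2 p.2 f) ts * X p m.
Proof.
elim: cs l f ts => [|c cs IH] l f [|t ts] loc /=.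
- rewrite !sum_bool2.
  by move: l m => [[] []] [[] []]; rewrite /= ?mulr0 ?mul0r ?add0r ?addr0 // mulrC.
- by rewrite !big1 // => p _; rewrite ?mulr0 ?mul0r.
- by rewrite !big1 // => p _; rewrite ?mulr0 ?mul0r.
(* [G] and [H] are the double rows over the remaining columns on the two sides, [b] being the letter
   below the first column. *)
pose G b p' := row (map A cs) p'.1 m.1 (row (map B cs) p'.2 m.2 (fun bs => f (b :: bs))) ts.
pose H b p p' := row (map B cs) p.1 p'.1 (row (map A cs) p.2 p'.2 (fun bs => f (b :: bs))) ts.
have IHb b p : \sum_p' X p p' * G b p' = \sum_p' H b p p' * X p' m.
  by apply: IH => c' l' m' t' b' c'cs; apply: loc; rewrite inE c'cs orbT.
transitivity (\sum_(p : bool * bool) X l p * \sum_(a : bool * bool) A c p.1 a.1 t a.2 *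
    \sum_(e : bool * bool) B c p.2 e.1 a.2 e.2 * G e.2 (a.1, e.1)).
  apply: eq_bigr => p _; congr (_ * _); apply: eq_bigr => a _; congr (_ * _).
  by rewrite row_sum; apply: eq_bigr => e _; rewrite row_scale.
transitivity (\sum_(b : bool) \sum_(p' : bool * bool) (\sum_(p : bool * bool) \sum_(k : bool)
    X l p * A c p.1 p'.1 t k * B c p.2 p'.2 k b) * G b p').
  by rewrite !sum_bool !sum_bool2 !sum_bool /=; ring.
transitivity (\sum_(b : bool) \sum_(p : bool * bool) \sum_(k : bool)
    B c l.1 p.1 t k * A c l.2 p.2 k b * \sum_p' X p p' * G b p').
  apply: eq_bigr => b _.
  under eq_bigr do rewrite loc ?mem_head // mulr_suml.
  rewrite exchange_big; apply: eq_bigr => p _.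
  under eq_bigr do rewrite mulr_suml.
  rewrite exchange_big; apply: eq_bigr => k _.
  by rewrite mulr_sumr; apply: eq_bigr => p' _; rewrite mulrA.
transitivity (\sum_(p' : bool * bool) (\sum_(a : bool * bool) B c l.1 a.1 t a.2 *
    \sum_(e : bool * bool) A c l.2 e.1 a.2 e.2 * H e.2 (a.1, e.1) p') * X p' m); last first.
  apply: eq_bigr => p _; congr (_ * _); apply: eq_bigr => a _; congr (_ * _).
  by rewrite row_sum; apply: eq_bigr => e _; rewrite row_scale.
under eq_bigr do under eq_bigr do under eq_bigr do rewrite IHb.
by rewrite !sum_bool !sum_bool2 !sum_bool /=; ring.
Qed.
End Rows.

(** * The six-vertex model on a triangle *)

Section SixVertex.
Variables (F : fieldType) (q : F).
Hypotheses (q0 : q != 0) (sq0 : sigma q != 0) (sq40 : sigma (q ^+ 4) != 0).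
Implicit Types (f g : bitseq -> F) (w ts : bitseq) (us cs : seq F).

(** * Vertex weights, the Yang-Baxter equation and the reflection equations *)

Definition bw (u : F) (l r t b : bool) : F := bulk_weight q l r t b u.
Definition lw (u : F) (t l : bool) : F := left_weight q t l u.
(** A horizontal edge pointing right enters the right boundary vertex, whereas [right_weight] asks
    whether it leaves it; hence the negation. *)
Definition rw (u : F) (t r : bool) : F := right_weight q t (~~ r) u.

(* The vertex of parameter z turned by 45 degrees, as an operator on the pairs
   of strands. *)
Definition cross (z : F) (p p' : bool * bool) : F := bw z p.1 p'.2 p'.1 p.2.

(** The left end of two adjacent rows: the boundary vertex of row [x], the bulk vertex where the two
    lines meet, and the boundary vertex of row [y]. [rcorner] is its counterpart on the right. *)
Definition lcorner (x y : F) (t m : bool * bool) : F :=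
  \sum_(p : bool * bool) lw x t.1 p.1 * bw (x * y) p.1 m.1 t.2 p.2 * lw y p.2 m.2.

Definition rcorner (x y : F) (m t : bool * bool) : F :=
  \sum_(p : bool * bool) bw (x * y) m.1 p.1 t.1 p.2 * rw y p.2 m.2 * rw x t.2 p.1.

(** The nonvanishing of [sigma q], and in the next lemma that of [sigma (q ^+ 4)], in the form in
    which [field] asks for it. *)
Lemma sq_neq1 : q * q - 1 != 0.
Proof.
by apply: contraNneq sq0 => /subr0_eq h; rewrite /sigma -[q in q - _](mulfK q0) h div1r subrr.
Qed.

Lemma q8_neq1 : (q * q) ^+ 4 - 1 != 0.
Proof.
apply: contraNneq sq40 => /subr0_eq h; rewrite /sigma.
have q40 : q ^+ 4 != 0 by rewrite expf_neq0.
by rewrite -[X in X - _](mulfK q40) -exprMn h div1r subrr.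
Qed.

(** Each choice of the six outer edges gives an identity of rational functions. For x = y the
    crossing has argument q^2 and is the identity on pairs of strands. *)
Lemma yang_baxter (x y c : F) (l m : bool * bool) (t b : bool) :
  x != 0 -> y != 0 -> c != 0 ->
  \sum_(p : bool * bool) \sum_(k : bool)
    cross (q ^+ 2 * y / x) l p * bw (x * c) p.1 m.1 t k * bw (y * c) p.2 m.2 k b =
  \sum_(p : bool * bool) \sum_(k : bool)
    bw (y * c) l.1 p.1 t k * bw (x * c) l.2 p.2 k b * cross (q ^+ 2 * y / x) p m.
Proof.
move=> x0 y0 c0; rewrite !sum_bool2 !sum_bool /cross /bw /=.
by move: l m t b => [[] []] [[] []] [] []; rewrite /bulk_weight /= /sigma; field;
   rewrite q0 x0 y0 c0 q8_neq1.
Qed.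

(** The boundary counterpart of the Yang-Baxter equation, again checked for each choice of the outer
    edges. *)
Lemma left_reflection (x y : F) (t m : bool * bool) :
  x != 0 -> y != 0 ->
  \sum_(s : bool * bool) lcorner x y s m * cross (q ^+ 2 * y / x) s t =
  \sum_(p : bool * bool) lcorner y x t p * cross (q ^+ 2 * y / x) p m.
Proof.
move=> x0 y0; rewrite /lcorner !sum_bool2 /cross /bw /lw /=.
by move: t m => [[] []] [[] []]; rewrite /bulk_weight /left_weight /= /sigma; field;
   rewrite q0 x0 y0 q8_neq1 sq_neq1.
Qed.

Lemma right_reflection (x y : F) (m t : bool * bool) :
  x != 0 -> y != 0 ->
  \sum_(p : bool * bool) cross (q ^+ 2 * y / x) m p * rcorner x y p t =
  \sum_(s : bool * bool) rcorner y x m s * cross (q ^+ 2 * y / x) s t.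
Proof.
move=> x0 y0; rewrite /rcorner !sum_bool2 /cross /bw /rw /=.
by move: m t => [[] []] [[] []]; rewrite /bulk_weight /right_weight /= /sigma; field;
   rewrite q0 x0 y0 q8_neq1 sq_neq1.
Qed.

(** * Rows with their right boundary, and the exchange of two adjacent parameters *)

Definition sites x cs : seq (site F) := [seq bw (x * c) | c <- cs].

Lemma size_sites x cs : size (sites x cs) = size cs.
Proof. exact: size_map. Qed.

Definition rrow x cs l f w : F :=
  if w is t :: w' then \sum_r rw x (last t w') r * row (sites x cs) l r f (belast t w')
  else 0.

(* The partition function of the triangular graph with the vertical edges of
   its top row prescribed by the word w (true = up). *)
Fixpoint Zword us v w : F :=
  if us is x :: us' then
    if w is t :: w' then \sum_l lw x t l * rrow x (us' ++ v :: rev us') l (Zword us' v) w'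
    else 0
  else 1.

(** The crossing placed above the letters k and k + 1 of the word. *)
Fixpoint crossat z k f w : F :=
  match k, w with
  | 0, t1 :: t2 :: w' => \sum_(s : bool * bool) cross z s (t1, t2) * f (s.1 :: s.2 :: w')
  | k'.+1, t :: w' => crossat z k' (fun b => f (t :: b)) w'
  | _, _ => 0
  end.

Lemma rrow_rcons x cs l f w t :
  rrow x cs l f (rcons w t) = \sum_r rw x t r * row (sites x cs) l r f w.
Proof. by case: w => [|t' w] //=; rewrite last_rcons belast_rcons. Qed.

Lemma eq_rrow x cs l f g w :
  (forall b, size b = size cs -> f b = g b) -> rrow x cs l f w = rrow x cs l g w.
Proof.
case: w => //= t w h; apply: eq_bigr => r _; congr (_ * _); apply: eq_row => b.
by rewrite size_sites; apply: h.
Qed.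

Lemma rrow_sum (I : finType) x cs l (h : I -> bitseq -> F) w :
  rrow x cs l (fun b => \sum_i h i b) w = \sum_i rrow x cs l (h i) w.
Proof.
case: w => [|t w] /=; first by rewrite big1_eq.
by rewrite exchange_big; apply: eq_bigr => r _; rewrite row_sum mulr_sumr.
Qed.

Lemma rrow_scale x cs l f c w : rrow x cs l (fun b => c * f b) w = c * rrow x cs l f w.
Proof.
case: w => [|t w] /=; first by rewrite mulr0.
by rewrite mulr_sumr; apply: eq_bigr => r _; rewrite row_scale mulrCA.
Qed.

Lemma eq_crossat z k f g w :
  (forall b, size b = size w -> f b = g b) -> crossat z k f w = crossat z k g w.
Proof.
elim: k f g w => [|k IH] f g [|t w] //= h.
  by case: w h => //= t' w h; apply: eq_bigr => s _; rewrite h.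
by apply: IH => b sz; apply: h; rewrite /= sz.
Qed.

Lemma crossat_sum (I : finType) z k (h : I -> bitseq -> F) w :
  crossat z k (fun b => \sum_i h i b) w = \sum_i crossat z k (h i) w.
Proof.
elim: k h w => [|k IH] h [|t w] //=; rewrite ?big1_eq //.
case: w => [|t' w]; first by rewrite big1_eq.
by rewrite exchange_big; apply: eq_bigr => s _; rewrite mulr_sumr.
Qed.

Lemma crossat_scale z k f c w : crossat z k (fun b => c * f b) w = c * crossat z k f w.
Proof.
elim: k f w => [|k IH] f [|t w] //=; rewrite ?mulr0 //.
case: w => [|t' w]; first by rewrite mulr0.
by rewrite mulr_sumr; apply: eq_bigr => s _; rewrite mulrCA.
Qed.

Lemma crossat_rcons z k f w t : (k.+1 < size w)%N ->
  crossat z k f (rcons w t) = crossat z k (fun b => f (rcons b t)) w.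
Proof.
elim: k f w => [|k IH] f [|t1 w] // h; last by rewrite /= IH.
by case: w h.
Qed.

Lemma crossat_cat z a f w :
  crossat z (size a) f (a ++ w) = crossat z 0 (fun b => f (a ++ b)) w.
Proof. by elim: a f => [|t a IH] f //=; rewrite IH. Qed.

(** A crossing of two adjacent columns slides from above a row to below it and swaps the columns.
    This is the Yang-Baxter equation with the row as third line. *)
Lemma crossat_row x y c cs1 cs2 l r f w : x != 0 -> y != 0 -> c != 0 ->
  crossat (q ^+ 2 * y / x) (size cs1)
    (row (sites c (cs1 ++ x :: y :: cs2)) l r f) w =
  row (sites c (cs1 ++ y :: x :: cs2)) l r (crossat (q ^+ 2 * y / x) (size cs1) f) w.
Proof.
move=> x0 y0 c0; elim: cs1 l f w => [|c1 cs1 IH] l f [|t w] //=; last first.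
  by rewrite crossat_sum; apply: eq_bigr => p _; rewrite crossat_scale IH.
case: w => [|t' w]; first by rewrite big1 // => p _; rewrite mulr0.
pose G (b1 b2 n : bool) := row (sites c cs2) n r (fun bs => f [:: b1, b2 & bs]) w.
transitivity (\sum_(b1 : bool) \sum_(b2 : bool) \sum_(n : bool) (\sum_(p : bool * bool) \sum_(k : bool)
    cross (c * x) (l, b1) p * bw (q ^+ 2 * y / x) p.1 t' t k * bw (c * y) p.2 n k b2) * G b1 b2 n).
  transitivity (\sum_(s : bool * bool) cross (q ^+ 2 * y / x) s (t, t') *
    (\sum_(p : bool * bool) bw (c * x) l p.1 s.1 p.2 *
    (\sum_(e : bool * bool) bw (c * y) p.1 e.1 s.2 e.2 * G p.2 e.2 e.1))) => //.
  by rewrite !sum_bool2 !sum_bool !sum_bool2 !sum_bool /cross /=; ring.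
transitivity (\sum_(b1 : bool) \sum_(b2 : bool) \sum_(n : bool) (\sum_(p : bool * bool) \sum_(k : bool)
    bw (c * y) l p.1 t k * bw (q ^+ 2 * y / x) b1 p.2 k b2 * cross (c * x) p (t', n)) * G b1 b2 n).
  do 3 (apply: eq_bigr => ? _); congr (_ * _).
  (* The equation is used with q^2 / x for its first parameter: the vertex of row [c] and column [x]
     becomes the turned one, and the crossing becomes a bulk vertex. *)
  have := yang_baxter (l, _) (t', _) t _ (mulf_neq0 (expf_neq0 2 q0) (invr_neq0 x0)) c0 y0.
  have -> : q ^+ 2 * c / (q ^+ 2 / x) = c * x by rewrite invf_div; field; rewrite q0.
  by rewrite mulrAC; apply.
have Gs (p : bool) b1 b2 : row (sites c cs2) p r
    (fun bs => \sum_(s : bool * bool) cross (q ^+ 2 * y / x) s (b1, b2) * f [:: s.1, s.2 & bs]) w =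
    \sum_(s : bool * bool) cross (q ^+ 2 * y / x) s (b1, b2) * G s.1 s.2 p.
  by rewrite row_sum; apply: eq_bigr => s _; rewrite row_scale.
rewrite [RHS](eq_bigr (fun p => bw (c * y) l p.1 t p.2 * (\sum_(e : bool * bool)
  bw (c * x) p.1 e.1 t' e.2 * (\sum_(s : bool * bool) cross (q ^+ 2 * y / x) s (p.2, e.2) * G s.1 s.2 e.1)))).
  by rewrite !sum_bool2 !sum_bool !sum_bool2 !sum_bool /cross /=; ring.
by move=> p _; congr (_ * _); apply: eq_bigr => e _; rewrite -Gs.
Qed.

Lemma crossat_rrow x y c cs1 cs2 l f w : x != 0 -> y != 0 -> c != 0 ->
  size w = (size cs1 + size cs2).+3 ->
  crossat (q ^+ 2 * y / x) (size cs1) (rrow c (cs1 ++ x :: y :: cs2) l f) w =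
  rrow c (cs1 ++ y :: x :: cs2) l (crossat (q ^+ 2 * y / x) (size cs1) f) w.
Proof.
move=> x0 y0 c0; case/lastP: w => // w t; rewrite size_rcons => -[sz].
rewrite crossat_rcons ?sz ?ltnS ?leq_addr // rrow_rcons.
rewrite (@eq_crossat _ _ _ (fun b => \sum_r rw c t r * row (sites c (cs1 ++ x :: y :: cs2)) l r f b));
  last by move=> b _; rewrite rrow_rcons.
by rewrite crossat_sum; apply: eq_bigr => r _; rewrite crossat_scale crossat_row.
Qed.

Lemma rrow_cons x c cs l f t w : (0 < size w)%N -> rrow x (c :: cs) l f (t :: w) =
  \sum_(p : bool * bool) bw (x * c) l p.1 t p.2 * rrow x cs p.1 (fun b => f (p.2 :: b)) w.
Proof.
case: w => // t' w _ /=; under eq_bigr do rewrite mulr_sumr.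
rewrite exchange_big; apply: eq_bigr => p _; rewrite mulr_sumr.
by apply: eq_bigr => r _; rewrite mulrCA.
Qed.

Lemma sum_exch (I J : finType) (a : I -> F) (b : J -> F) (X : I -> J -> F) :
  \sum_i a i * \sum_j b j * X i j = \sum_j b j * \sum_i a i * X i j.
Proof.
under eq_bigr do rewrite mulr_sumr; rewrite exchange_big; apply: eq_bigr => j _.
by rewrite mulr_sumr; apply: eq_bigr => i _; rewrite mulrCA.
Qed.

Lemma lcornerE x y t (X : bool * bool -> F) :
  \sum_l lw x t.1 l * \sum_(p : bool * bool) bw (x * y) l p.1 t.2 p.2 *
    \sum_l2 lw y p.2 l2 * X (p.1, l2) = \sum_m lcorner x y t m * X m.
Proof. by rewrite /lcorner !sum_bool2 !sum_bool !sum_bool2 !sum_bool /=; ring. Qed.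

Lemma rcornerE x y t (X : bool * bool -> F) :
  \sum_r rw x t.2 r * \sum_(e : bool * bool) bw (x * y) e.1 r t.1 e.2 *
    \sum_r2 rw y e.2 r2 * X (e.1, r2) = \sum_n rcorner x y n t * X n.
Proof. by rewrite /rcorner !sum_bool2 !sum_bool !sum_bool2 !sum_bool /=; ring. Qed.

Lemma Zword_cons x us v t w : Zword (x :: us) v (t :: w) =
  \sum_l lw x t l * rrow x (us ++ v :: rev us) l (Zword us v) w.
Proof. by []. Qed.

(** The form of the top two rows to which [train] applies: two corners, and between them two rows
    over the same columns. *)
Lemma Zword_two x y us v s ts t : size ts = (size us).*2.+1 ->
  Zword (x :: y :: us) v (s.1 :: s.2 :: rcons (rcons ts t.1) t.2) =
  \sum_m \sum_n lcorner x y s m * rcorner x y n t *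
    row (sites x (us ++ v :: rev us)) m.1 n.1
      (row (sites y (us ++ v :: rev us)) m.2 n.2 (Zword us v)) ts.
Proof.
move=> sz; set cs := us ++ v :: rev us.
have szc : size cs = size ts by rewrite sz size_cat /= size_rev addnS addnn.
pose G m n := row (sites x cs) m.1 n.1 (row (sites y cs) m.2 n.2 (Zword us v)) ts.
transitivity (\sum_l lw x s.1 l * \sum_r rw x t.2 r *
    \sum_(p : bool * bool) bw (x * y) l p.1 s.2 p.2 *
    \sum_(e : bool * bool) bw (x * y) e.1 r t.1 e.2 *
    \sum_l2 lw y p.2 l2 * \sum_r2 rw y e.2 r2 * G (p.1, l2) (e.1, r2)).
  rewrite Zword_cons rev_cons -!rcons_cons; apply: eq_bigr => l _; congr (_ * _).
  rewrite rrow_rcons; apply: eq_bigr => r _; congr (_ * _).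
  rewrite cat_cons -rcons_cat /sites /= map_rcons -/(sites x cs).
  apply: eq_bigr => p _; congr (_ * _).
  rewrite row_rcons ?size_sites ?szc //; apply: eq_bigr => e _; congr (_ * _).
  rewrite row_sum; apply: eq_bigr => l2 _; rewrite row_scale; congr (_ * _).
  under eq_row do rewrite rrow_rcons.
  by rewrite row_sum; apply: eq_bigr => r2 _; rewrite row_scale.
transitivity (\sum_m lcorner x y s m * \sum_n rcorner x y n t * G m n); last first.
  by apply: eq_bigr => m _; rewrite mulr_sumr; apply: eq_bigr => n _; rewrite mulrA.
under [RHS]eq_bigr do rewrite -rcornerE.
rewrite -(lcornerE x y s (fun m => \sum_r rw x t.2 r * \sum_(e : bool * bool)
  bw (x * y) e.1 r t.1 e.2 * \sum_r2 rw y e.2 r2 * G m (e.1, r2))).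
apply: eq_bigr => l _; congr (_ * _); rewrite sum_exch; apply: eq_bigr => p _; congr (_ * _).
rewrite -[RHS]sum_exch; apply: eq_bigr => r _; congr (_ * _).
by rewrite -[RHS]sum_exch.
Qed.

(** The crossing enters at the left corner by the left reflection equation, runs through both rows
    by [train], and leaves at the right corner by the right reflection equation, above the last two
    letters. *)
Lemma Zword_swap_first x y us v w : x != 0 -> y != 0 -> v != 0 -> all (predC1 0) us ->
  size w = (size us + size us).+4.+1 ->
  crossat (q ^+ 2 * y / x) 0 (Zword (x :: y :: us) v) w =
  crossat (q ^+ 2 * y / x) (size us + size us).+3 (Zword (y :: x :: us) v) w.
Proof.
move=> x0 y0 v0 us0; set z := _ / x.
case: w => [|t0 [|t1 w]] //; case/lastP: w => // w u1; case/lastP: w => [|ts u0] //.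
move=> sw; have sz : size ts = (size us + size us).+1 by move: sw; rewrite /= !size_rcons => -[].
have sz' : size ts = (size us).*2.+1 by rewrite sz addnn.
set cs := us ++ v :: rev us.
have cs0 c : c \in cs -> c != 0.
  by rewrite mem_cat inE mem_rev => /or3P[/(allP us0)|/eqP->|/(allP us0)].
pose G x y m n := row (sites x cs) m.1 n.1 (row (sites y cs) m.2 n.2 (Zword us v)) ts.
have trainG m n : \sum_p cross z m p * G x y p n = \sum_p G y x m p * cross z p n.
  by apply: train => c l m' t b /cs0 c0; apply: yang_baxter.
transitivity (\sum_(s : bool * bool) cross z s (t0, t1) *
    \sum_m \sum_n lcorner x y s m * rcorner x y n (u0, u1) * G x y m n).
  by apply: eq_bigr => s _; rewrite -Zword_two.
transitivity (\sum_m \sum_n lcorner y x (t0, t1) m * G y x m n *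
    \sum_p cross z n p * rcorner x y p (u0, u1)).
  transitivity (\sum_m \sum_n (\sum_s lcorner x y s m * cross z s (t0, t1)) *
      rcorner x y n (u0, u1) * G x y m n).
    under eq_bigr do rewrite mulr_sumr; rewrite exchange_big; apply: eq_bigr => m _.
    under eq_bigr do rewrite mulr_sumr; rewrite exchange_big; apply: eq_bigr => n _.
    by rewrite !mulr_suml; apply: eq_bigr => s _; ring.
  under eq_bigr do under eq_bigr do rewrite left_reflection //.
  transitivity (\sum_m \sum_n lcorner y x (t0, t1) m *
      (\sum_p cross z m p * G x y p n) * rcorner x y n (u0, u1)).
    rewrite exchange_big [RHS]exchange_big; apply: eq_bigr => n _.
    under eq_bigr do rewrite !mulr_suml.
    rewrite exchange_big; apply: eq_bigr => m _.
    by rewrite mulr_sumr mulr_suml; apply: eq_bigr => p _; rewrite -/z; ring.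
  apply: eq_bigr => m _; under eq_bigr do rewrite trainG mulr_sumr mulr_suml.
  rewrite exchange_big; apply: eq_bigr => n _.
  by rewrite mulr_sumr; apply: eq_bigr => p _; ring.
under eq_bigr do under eq_bigr do rewrite right_reflection //.
rewrite -[in RHS]cats1 -[in RHS](cats1 ts) -catA -sz.
change (crossat z _ _ _) with
  (crossat z (size ts) (fun b => Zword (y :: x :: us) v [:: t0, t1 & b]) (ts ++ [:: u0; u1])).
rewrite (crossat_cat _ _ (fun b => Zword (y :: x :: us) v [:: t0, t1 & b])) /=.
transitivity (\sum_(s : bool * bool) cross z s (u0, u1) *
    \sum_m \sum_n lcorner y x (t0, t1) m * rcorner y x n s * G y x m n); last first.
  apply: eq_bigr => s _; rewrite -Zword_two //.
  by rewrite -cats1 -cats1 -catA.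
under [RHS]eq_bigr do rewrite mulr_sumr; rewrite [RHS]exchange_big; apply: eq_bigr => m _.
under [RHS]eq_bigr do rewrite mulr_sumr; rewrite [RHS]exchange_big; apply: eq_bigr => n _.
by rewrite !mulr_sumr; apply: eq_bigr => s _; rewrite -/z; ring.
Qed.

(** The crossing goes down the two columns through the rows of [us1], is carried to the other side
    by [Zword_swap_first], and comes back up along the mirror columns. *)
Lemma Zword_swap x y us1 us2 v w : x != 0 -> y != 0 -> v != 0 ->
  all (predC1 0) us1 -> all (predC1 0) us2 ->
  size w = (size (us1 ++ x :: y :: us2)).*2.+1 ->
  crossat (q ^+ 2 * y / x) (size us1) (Zword (us1 ++ x :: y :: us2) v) w =
  crossat (q ^+ 2 * y / x) (size us1 + (size us2 + size us2).+3)
    (Zword (us1 ++ y :: x :: us2) v) w.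
Proof.
move=> x0 y0 v0 + us20; elim: us1 w => [|x1 us1 IH] w /=.
  by move=> _ sz; apply: Zword_swap_first => //; rewrite sz doubleS doubleS addnn.
case/andP=> x10 us10; case: w => // t w [sz]; set z := _ / x.
pose C1 := us2 ++ v :: rev us2; pose D := rev us1.
have EC a b : (us1 ++ a :: b :: us2) ++ v :: rev (us1 ++ a :: b :: us2) =
    us1 ++ a :: b :: (C1 ++ b :: a :: D).
  by rewrite rev_cat !rev_cons -!cats1 /C1 /D -!catA.
have szw : size w = (size us1 + size (C1 ++ y :: x :: D)).+3.
  rewrite sz /C1 /D; size_lia.
rewrite (@eq_crossat _ _ _ (fun b => \sum_l lw x1 t l *
   rrow x1 (us1 ++ x :: y :: (C1 ++ y :: x :: D)) l (Zword (us1 ++ x :: y :: us2) v) b)); last first.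
  by move=> b _; rewrite -EC.
rewrite [RHS](@eq_crossat _ _ _ (fun b => \sum_l lw x1 t l *
   rrow x1 ((us1 ++ y :: x :: C1) ++ x :: y :: D) l (Zword (us1 ++ y :: x :: us2) v) b)); last first.
  by move=> b _; rewrite EC -[in RHS]catA.
rewrite !crossat_sum; apply: eq_bigr => l _; rewrite !crossat_scale; congr (_ * _).
rewrite crossat_rrow // -/z.
have sk : (size us1 + (size us2 + size us2).+3)%N = size (us1 ++ y :: x :: C1).
  rewrite /C1; size_lia.
rewrite sk crossat_rrow //; last first.
  rewrite szw; size_lia.
rewrite -[in RHS]catA; apply: eq_rrow => b szb; rewrite IH // -?sk -?/z //.
rewrite szb /C1 /D; size_lia.
Qed.

(** * Symmetry of the partition function with all top edges up *)

Definition Zup (us : seq F) (v : F) : F := Zword us v (nseq (size us).*2.+1 true).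

Lemma crossat_up z k f N : (k.+1 < N)%N ->
  crossat z k f (nseq N true) = sigma (q ^+ 2 * z) / sigma (q ^+ 4) * f (nseq N true).
Proof.
elim: k N f => [|k IH] [|N] f //; last by move=> h; rewrite /= IH.
case: N => // N _ /=; rewrite sum_bool2 /cross /bw /bulk_weight /=.
by rewrite !mul0r !addr0.
Qed.

(** Above letters all equal to [true] the crossing is a scalar, the same at both of its positions;
    being nonzero, it cancels. *)
Lemma Zup_swap (x y : F) us1 us2 v : x != 0 -> y != 0 -> v != 0 ->
  all (predC1 0) us1 -> all (predC1 0) us2 -> sigma (q ^+ 4 * y / x) != 0 ->
  Zup (us1 ++ x :: y :: us2) v = Zup (us1 ++ y :: x :: us2) v.
Proof.
move=> x0 y0 v0 us10 us20 s0.
have sz : size (us1 ++ y :: x :: us2) = size (us1 ++ x :: y :: us2) by rewrite !size_cat.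
rewrite /Zup sz; set w := nseq _ _.
have := Zword_swap x0 y0 v0 us10 us20 (size_nseq _ true).
rewrite !crossat_up; [|size_lia|size_lia].
have -> : q ^+ 2 * (q ^+ 2 * y / x) = q ^+ 4 * y / x by field.
by apply: mulfI; rewrite mulf_neq0 ?invr_eq0.
Qed.

Lemma Zup_front (x : F) us1 us2 v : v != 0 -> all (predC1 0) (us1 ++ x :: us2) ->
  all (fun y => sigma (q ^+ 4 * x / y) != 0) us1 ->
  Zup (us1 ++ x :: us2) v = Zup (x :: us1 ++ us2) v.
Proof.
elim/last_ind: us1 us2 => //= us1 y IH us2 v0.
rewrite all_cat !all_rcons /= => /and3P[/andP[y0 us10] x0 us20] /andP[sy s1].
rewrite cat_rcons Zup_swap // IH ?all_cat //=; last by rewrite us10 /= x0 /= y0.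
by rewrite cat_rcons.
Qed.

(** * The recursion at u_1 u_{n+1} = q^2 *)

(* A line coming up the central column, turning right and passing above the
   columns cs towards the right boundary. *)
Definition hook x cs f w := \sum_b rrow x cs b (fun d => f (b :: d)) w.

(* A vertical line of parameter x coming up left of the columns cs and crossing
   them to the right. *)
Definition over x cs f w :=
  if w is t :: w' then
    \sum_b row [seq bw (q ^+ 2 * c / x) | c <- cs] b (last t w')
             (fun d => f (b :: d)) (belast t w')
  else 0.

Lemma over_rcons x cs f w t : over x cs f (rcons w t) =
  \sum_b row [seq bw (q ^+ 2 * c / x) | c <- cs] b t (fun d => f (b :: d)) w.
Proof. by case: w => [|t' w] //=; rewrite last_rcons belast_rcons. Qed.

Lemma rrow_cons2 x c cs l b f w t : rrow x (c :: cs) l f (b :: rcons w t) =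
  \sum_r rw x t r * \sum_(p : bool * bool) bw (x * c) l p.1 b p.2 *
    row (sites x cs) p.1 r (fun d => f (p.2 :: d)) w.
Proof. by rewrite -rcons_cons rrow_rcons. Qed.

Lemma rrow_rcons2 x y cs b f ts t : size ts = size cs ->
  rrow x (rcons cs y) b f (rcons (rcons ts t.1) t.2) =
  \sum_r rw x t.2 r * \sum_(e : bool * bool) bw (x * y) e.1 r t.1 e.2 *
    row (sites x cs) b e.1 (fun a => f (rcons a e.2)) ts.
Proof.
move=> sz; rewrite rrow_rcons /sites map_rcons; apply: eq_bigr => r _.
by rewrite row_rcons ?size_map.
Qed.

(** Row [y] moves from below the hook to above it, by the train argument over [cs] followed by the
    right reflection equation. A crossing of the last two letters remains on top. *)
Lemma hook_step x y cs m f ts t : x != 0 -> y != 0 -> all (predC1 0) cs ->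
  size ts = size cs ->
  hook x (rcons cs y) (rrow y (q ^+ 2 / x :: cs) m f) (rcons (rcons ts t.1) t.2) =
  \sum_(s : bool * bool) cross (q ^+ 2 * y / x) s t *
    rrow y (rcons cs x) m (hook x cs f) (rcons (rcons ts s.1) s.2).
Proof.
move=> x0 y0 /allP cs0 sz; set z := q ^+ 2 * y / x.
(* The vertex of row [y] on the central column has exactly the argument of the crossing, so it can
   start the train argument. *)
have zE : y * (q ^+ 2 / x) = z by rewrite /z mulrCA mulrA.
pose Gxy (b' : bool) (p n : bool * bool) := row (sites x cs) p.1 n.1
   (row (sites y cs) p.2 n.2 (fun d => f (b' :: d))) ts.
pose Gyx (b' : bool) (p n : bool * bool) := row (sites y cs) p.1 n.1
   (row (sites x cs) p.2 n.2 (fun d => f (b' :: d))) ts.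
have trainG b' p n : \sum_k cross z p k * Gxy b' k n = \sum_k Gyx b' p k * cross z k n.
  by apply: train => c l' m' t' b /cs0 c0; apply: yang_baxter.
transitivity (\sum_(b' : bool) \sum_(p : bool * bool) cross z (m, b') p *
    \sum_n Gxy b' p n * rcorner x y n t).
  transitivity (\sum_b \sum_n rcorner x y n t *
      \sum_(p : bool * bool) bw z m p.1 b p.2 * Gxy p.2 (b, p.1) n).
    apply: eq_bigr => b _; rewrite rrow_rcons2 // -rcornerE; apply: eq_bigr => r' _.
    congr (_ * _); apply: eq_bigr => e _; congr (_ * _).
    under eq_row do rewrite rrow_cons2 zE.
    rewrite row_sum; apply: eq_bigr => r _; rewrite row_scale row_sum; congr (_ * _).
    by apply: eq_bigr => p _; rewrite row_scale.
  rewrite exchange_big; under [RHS]eq_bigr do under eq_bigr do rewrite mulr_sumr.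
  under [RHS]eq_bigr do rewrite exchange_big.
  rewrite [RHS]exchange_big; apply: eq_bigr => n _; rewrite -mulr_sumr.
  by rewrite !sum_bool !sum_bool2 /cross /=; ring.
transitivity (\sum_(b' : bool) \sum_(p : bool * bool) Gyx b' (m, b') p *
    \sum_(s : bool * bool) rcorner y x p s * cross z s t).
  apply: eq_bigr => b' _.
  transitivity (\sum_p \sum_n cross z (m, b') p * Gxy b' p n * rcorner x y n t).
    by apply: eq_bigr => p _; rewrite mulr_sumr; apply: eq_bigr => n _; rewrite mulrA.
  transitivity (\sum_p \sum_n Gyx b' (m, b') p * cross z p n * rcorner x y n t); last first.
    apply: eq_bigr => p _; rewrite -(right_reflection p t x0 y0) mulr_sumr.
    by apply: eq_bigr => n _; rewrite mulrA.
  rewrite exchange_big [RHS]exchange_big; apply: eq_bigr => n _ /=.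
  by rewrite -!mulr_suml trainG.
transitivity (\sum_(s : bool * bool) cross z s t *
    \sum_n rcorner y x n s * \sum_b' Gyx b' (m, b') n).
  under eq_bigr do under eq_bigr do rewrite mulr_sumr.
  under eq_bigr do rewrite exchange_big; rewrite exchange_big; apply: eq_bigr => s _ /=.
  rewrite exchange_big mulr_sumr; apply: eq_bigr => n _ /=.
  by rewrite !mulr_sumr; apply: eq_bigr => b' _; ring.
apply: eq_bigr => s _; congr (_ * _); rewrite rrow_rcons2 // -rcornerE; apply: eq_bigr => r _.
congr (_ * _); apply: eq_bigr => e _; congr (_ * _).
under [RHS]eq_row do rewrite /hook; rewrite row_sum.
transitivity (\sum_b' \sum_r2 rw x e.2 r2 * Gyx b' (m, b') (e.1, r2)).
  by rewrite exchange_big; apply: eq_bigr => r2 _; rewrite mulr_sumr.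
apply: eq_bigr => b' _; under [RHS]eq_row do rewrite rrow_rcons.
by rewrite row_sum; apply: eq_bigr => r2 _; rewrite row_scale.
Qed.
(** The crossing left by [hook_step] becomes the last vertex of the longer line [over], which rises
    above row [y]; the column of parameter [x] moves from the right end of that row to the
    centre. *)
Lemma over_step x y cs m f ts t : x != 0 -> y != 0 -> all (predC1 0) cs ->
  size ts = size cs ->
  \sum_(s : bool * bool) cross (q ^+ 2 * y / x) s t *
    rrow y (rcons cs x) m (over x cs f) (rcons (rcons ts s.1) s.2) =
  over x (rcons cs y) (rrow y (x :: cs) m f) (rcons (rcons ts t.1) t.2).
Proof.
move=> x0 y0 /allP cs0 sz; set z := q ^+ 2 * y / x.
pose O := [seq bw (q ^+ 2 * c / x) | c <- cs].
pose GO (b' : bool) (p n : bool * bool) := row O p.1 n.1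
   (row (sites y cs) p.2 n.2 (fun d => f (b' :: d))) ts.
pose GY (b' : bool) (p n : bool * bool) := row (sites y cs) p.1 n.1
   (row O p.2 n.2 (fun d => f (b' :: d))) ts.
have trainG b' p n :
    \sum_k cross (y * x) p k * GO b' k n = \sum_k GY b' p k * cross (y * x) k n.
  apply: (train (A := fun c => bw (q ^+ 2 * c / x))) => c l' m' t' b /cs0 c0.
  have := yang_baxter l' m' t' b (mulf_neq0 (expf_neq0 2 q0) (invr_neq0 x0)) y0 c0.
  have -> : q ^+ 2 * y / (q ^+ 2 / x) = y * x by rewrite invf_div; field; rewrite q0.
  by rewrite (mulrAC (q ^+ 2) x^-1).
transitivity (\sum_s cross z s t * \sum_r rw y s.2 r *
    \sum_b' \sum_k GY b' (m, b') k * cross (y * x) k (s.1, r)).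
  apply: eq_bigr => s _; rewrite rrow_rcons2 //; congr (_ * _); apply: eq_bigr => r _.
  congr (_ * _); rewrite exchange_big; apply: eq_bigr => k _.
  under eq_row do rewrite over_rcons.
  by rewrite row_sum mulr_sumr; apply: eq_bigr => b' _; rewrite mulrC.
rewrite over_rcons map_rcons -/O.
transitivity (\sum_b \sum_s cross z s t * \sum_r rw y s.2 r *
    \sum_(p : bool * bool) bw (y * x) m p.1 b p.2 * GO p.2 (b, p.1) (s.1, r)); last first.
  apply: eq_bigr => b _; rewrite row_rcons ?size_map //; apply: eq_bigr => s _.
  congr (_ * _); under [RHS]eq_row do rewrite rrow_cons2.
  rewrite row_sum; apply: eq_bigr => r _; rewrite row_scale row_sum; congr (_ * _).
  by apply: eq_bigr => p _; rewrite row_scale.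
rewrite [RHS]exchange_big; apply: eq_bigr => s _; rewrite -mulr_sumr; congr (_ * _).
rewrite [RHS]exchange_big; apply: eq_bigr => r _; rewrite -mulr_sumr; congr (_ * _).
under eq_bigr do rewrite -trainG.
by rewrite !sum_bool !sum_bool2 /cross /=; ring.
Qed.

Lemma hook_ext x cs f g w : (forall d, size d = (size cs).+1 -> f d = g d) ->
  hook x cs f w = hook x cs g w.
Proof.
move=> h; apply: eq_bigr => b _; apply: eq_rrow => d sz; apply: h; by rewrite /= sz.
Qed.

Lemma over_ext x cs f g w : (forall d, size d = size w -> f d = g d) -> size w = (size cs).+1 ->
  over x cs f w = over x cs g w.
Proof.
case: w => [|t w] //= h [sz]; apply: eq_bigr => b _; apply: eq_row => d.
by rewrite size_map => szd; apply: h; rewrite /= szd sz.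
Qed.

Lemma rrow_row x cs l S l' r' (h : bitseq -> bitseq -> F) a w :
  rrow x cs l (fun d => row S l' r' (h^~ d) a) w = row S l' r' (fun a => rrow x cs l (h a) w) a.
Proof.
case: w => [|t w] /=; first by rewrite row0.
rewrite row_sum; apply: eq_bigr => r _; rewrite row_scale; congr (_ * _).
exact: (row_comm _ _ _ _ _ _ (fun d a => h a d)).
Qed.

Lemma hook_row x cs S l' r' (h : bitseq -> bitseq -> F) a w :
  hook x cs (fun d => row S l' r' (h^~ d) a) w = row S l' r' (fun a => hook x cs (h a) w) a.
Proof.
by rewrite /hook row_sum; apply: eq_bigr => b _; rewrite rrow_row.
Qed.

Lemma over_row x cs S l' r' (h : bitseq -> bitseq -> F) a w :
  over x cs (fun d => row S l' r' (h^~ d) a) w = row S l' r' (fun a => over x cs (h a) w) a.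
Proof.
case: w => [|t w] /=; first by rewrite row0.
rewrite row_sum; apply: eq_bigr => b _.
exact: (row_comm _ _ _ _ _ _ (fun d a => h a (b :: d))).
Qed.

Lemma hook_sum (I : finType) x cs (h : I -> bitseq -> F) w :
  hook x cs (fun d => \sum_i h i d) w = \sum_i hook x cs (h i) w.
Proof. by rewrite /hook exchange_big; apply: eq_bigr => b _; rewrite rrow_sum. Qed.

Lemma hook_scale x cs f c w : hook x cs (fun d => c * f d) w = c * hook x cs f w.
Proof. by rewrite mulr_sumr; apply: eq_bigr => b _; rewrite rrow_scale. Qed.

Lemma over_sum (I : finType) x cs (h : I -> bitseq -> F) w :
  over x cs (fun d => \sum_i h i d) w = \sum_i over x cs (h i) w.
Proof.
case: w => [|t w] /=; first by rewrite big1_eq.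
by rewrite exchange_big; apply: eq_bigr => b _; rewrite row_sum.
Qed.

Lemma over_scale x cs f c w : over x cs (fun d => c * f d) w = c * over x cs f w.
Proof.
case: w => [|t w] /=; first by rewrite mulr0.
by rewrite mulr_sumr; apply: eq_bigr => b _; rewrite row_scale.
Qed.

(** Cuts the first row just left of the central column, so that its left half stays in place while
    the line on the right is deformed. *)
Lemma Zword_split x us v t a d : size a = size us -> d != [::] ->
  Zword (x :: us) v (t :: a ++ d) =
  \sum_(p : bool * bool) lw x t p.1 *
    row (sites x us) p.1 p.2 (fun a => rrow x (v :: rev us) p.2 (fun d => Zword us v (a ++ d)) d) a.
Proof.
case/lastP: d => // d t' sz _; rewrite Zword_cons.
transitivity (\sum_l \sum_k lw x t l * row (sites x us) l k
   (fun a => rrow x (v :: rev us) k (fun d => Zword us v (a ++ d)) (rcons d t')) a);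
  last by rewrite pair_bigA.
apply: eq_bigr => l _; rewrite -mulr_sumr -rcons_cat rrow_rcons; congr (_ * _).
rewrite /sites map_cat.
under eq_bigr do rewrite row_cat ?size_map // mulr_sumr.
rewrite exchange_big; apply: eq_bigr => k _.
under [RHS]eq_row do rewrite rrow_rcons.
by rewrite row_sum; apply: eq_bigr => r _; rewrite row_scale.
Qed.

(* The line is pulled below all the others through the right boundary, where
   it only meets the free bottom edge. *)
Lemma hook_Zword x us a w : x != 0 -> all (predC1 0) us ->
  size a = size us -> size w = (size us).+1 ->
  hook x (rev us) (fun d => Zword us (q ^+ 2 / x) (a ++ d)) w =
  (1 + sigma (q / x) / sigma q) * over x (rev us) (fun d => Zword us x (a ++ d)) w.
Proof.
move=> x0; elim: us a w => [|y us IH] a w /=.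
  (* With no row left, the line has only its right boundary vertex. The sum over its free end gives
     both boundary weights, whatever [t] is. *)
  case: w => [|t [|]] //= _ _ _; rewrite /hook /= !sum_bool /= /rw /right_weight.
  by case: t => /=; ring.
case/andP=> y0 us0; case: a => // a0 a [sza].
case/lastP: w => // w t2; case/lastP: w => [|w t1]; rewrite ?size_rcons // => -[szw].
have -> : rev (y :: us) = rcons (rev us) y by rewrite rev_cons.
have us0' : all (predC1 0) (rev us) by rewrite all_rev.
rewrite (@hook_ext _ _ _ (fun d => \sum_(p : bool * bool) lw y a0 p.1 *
    row (sites y us) p.1 p.2 (fun a => rrow y (q ^+ 2 / x :: rev us) p.2
      (fun d => Zword us (q ^+ 2 / x) (a ++ d)) d) a)); last first.
  by move=> [|d0 d] // sz; rewrite -Zword_split.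
have -> : over x (rcons (rev us) y) (fun d => Zword (y :: us) x ((a0 :: a) ++ d)) (rcons (rcons w t1) t2) =
    over x (rcons (rev us) y) (fun d => \sum_(p : bool * bool) lw y a0 p.1 *
    row (sites y us) p.1 p.2 (fun a => rrow y (x :: rev us) p.2
      (fun d => Zword us x (a ++ d)) d) a) (rcons (rcons w t1) t2).
  apply: over_ext; last by rewrite !size_rcons size_rev szw.
  by rewrite !size_rcons => -[|d0 d] // _; rewrite -Zword_split.
rewrite hook_sum over_sum mulr_sumr; apply: eq_bigr => p _.
rewrite hook_scale over_scale mulrCA; congr (_ * _).
(* The left half of row [y] acts on other letters, hence commutes with both lines. *)
rewrite hook_row over_row -row_scale; apply: eq_row => b; rewrite size_sites => szb.
rewrite (hook_step _ _ (t1, t2)) ?size_rev // -(over_step _ _ (t1, t2)) ?size_rev // mulr_sumr.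
apply: eq_bigr => s _; rewrite [RHS]mulrCA; congr (_ * _); rewrite -rrow_scale; apply: eq_rrow => d.
by rewrite size_rcons size_rev => szd; apply: IH.
Qed.
(** At a vertex whose right and upper edges point out, the other two edges point in; so the row is
    frozen, from right to left. *)
Lemma row_up (T : Type) (g : T -> F) (cs : seq T) l f :
  row [seq bw (g c) | c <- cs] l true f (nseq (size cs) true) =
  if l then (\prod_(c <- cs) (sigma (q ^+ 2 * g c) / sigma (q ^+ 4))) * f (nseq (size cs) true)
  else 0.
Proof.
elim: cs l f => [|c cs IH] l f /=; first by case: l; rewrite ?big_nil ?mul1r.
rewrite sum_bool2 !IH big_cons /bw /bulk_weight /=.
by case: l => /=; rewrite ?mul0r ?mulr0 ?addr0 // mulrA.
Qed.

Lemma Zup_recursion x us : x != 0 -> all (predC1 0) us ->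
  Zup (x :: us) (q ^+ 2 / x) =
  sigma (q * x) / sigma q * (1 + sigma (q / x) / sigma q) *
  (\prod_(c <- us) (sigma (q ^+ 2 * x * c) / sigma (q ^+ 4) *
                    (sigma (q ^+ 4 * c / x) / sigma (q ^+ 4)))) * Zup us x.
Proof.
move=> x0 us0; rewrite /Zup.
set up' := nseq (size us).+1 true.
have -> : nseq (size (x :: us)).*2.+1 true = true :: nseq (size us) true ++ true :: up'.
  by rewrite /up' -[true :: nseq _.+1 _]/(nseq (size us).+2 true) -nseqD /= addnS addnS addnn.
rewrite Zword_split ?size_nseq //.
(* At argument q^2 the central vertex splits into a strand from the left edge to the upper edge,
   which forces [k] to be [true], and a strand from the lower edge to the right edge, which is the
   hook. *)
have rc (k : bool) a : rrow x (q ^+ 2 / x :: rev us) k (fun d => Zword us (q ^+ 2 / x) (a ++ d)) (true :: up') =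
    k%:R * hook x (rev us) (fun d => Zword us (q ^+ 2 / x) (a ++ d)) up'.
  rewrite rrow_cons // mulrCA divff // mulr1 sum_bool2 /hook sum_bool /bw /bulk_weight /=.
  have -> : sigma (q ^+ 2 * q ^+ 2) / sigma (q ^+ 4) = 1 by rewrite -exprD divff.
  have -> : sigma (q ^+ 2 / q ^+ 2) / sigma (q ^+ 4) = 0.
    by rewrite divff ?expf_neq0 // /sigma invr1 subrr mul0r.
  by case: k => /=; ring.
transitivity (\sum_(p : bool * bool) lw x true p.1 * (p.2%:R *
    row (sites x us) p.1 p.2 (fun a => hook x (rev us) (fun d => Zword us (q ^+ 2 / x) (a ++ d)) up')
      (nseq (size us) true))).
  by apply: eq_bigr => p _; congr (_ * _); rewrite -row_scale; apply: eq_row => a _; apply: rc.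
rewrite sum_bool2 /= !mul0r !mulr0 !addr0 !mul1r /sites !row_up addr0.
rewrite hook_Zword ?size_nseq // /lw /left_weight eqxx.
have -> : up' = rcons (nseq (size (rev us)) true) true.
  by rewrite size_rev -cats1 -(nseqD _ 1) addn1.
rewrite over_rcons sum_bool !row_up addr0.
have pr (h : F -> F) : \prod_(c <- rev us) h c = \prod_(c <- us) h c.
  by apply: perm_big; rewrite perm_rev.
rewrite pr [in RHS]big_split /=.
have -> : nseq (size us) true ++ true :: nseq (size (rev us)) true = nseq (size us).*2.+1 true.
  by rewrite size_rev -(nseqD _ (size us).+1) addnS addnn.
have -> : \prod_(c <- us) (sigma (q ^+ 2 * (x * c)) / sigma (q ^+ 4)) =
    \prod_(c <- us) (sigma (q ^+ 2 * x * c) / sigma (q ^+ 4)).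
  by apply: eq_bigr => c _; rewrite mulrA.
have -> : \prod_(c <- us) (sigma (q ^+ 2 * (q ^+ 2 * c / x)) / sigma (q ^+ 4)) =
    \prod_(c <- us) (sigma (q ^+ 4 * c / x) / sigma (q ^+ 4)).
  by apply: eq_bigr => c _; congr (sigma _ / _); field.
by rewrite -[true :: _]/(nseq _.+1 _); ring.
Qed.

(** * Evenness in the first parameter and inversion of all parameters *)

Lemma sigmaN (x : F) : sigma (- x) = - sigma x.
Proof. by rewrite /sigma invrN opprB opprK addrC. Qed.

Let sgn (b : bool) : F := if b then 1 else -1.

Lemma sgnK b : sgn b * sgn b = 1.
Proof. by case: b; rewrite /sgn ?mulrNN mulr1. Qed.

(** The nonzero weights with [l = r] are odd in u, and those with [l != r] are constant. *)
Lemma bw_opp u l r t b : bw (- u) l r t b = - sgn l * sgn r * bw u l r t b.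
Proof.
rewrite /bw /bulk_weight invrN !mulrN !sigmaN.
by case: l r t b => [] [] [] []; rewrite /sgn /=; ring.
Qed.

Lemma sites_opp x cs l r f w : row (sites (- x) cs) l r f w =
  (-1) ^+ size cs * sgn l * sgn r * row (sites x cs) l r f w.
Proof.
elim: cs l f w => [|c cs IH] l f [|t w] //=; rewrite ?mulr0 //.
  by case: eqP => [->|_]; rewrite ?mulr0 // mul1r sgnK mul1r.
rewrite mulr_sumr; apply: eq_bigr => p _.
rewrite (mulNr x) bw_opp IH exprS -[RHS]mul1r -[X in _ = X * _](sgnK p.1); ring.
Qed.

(** The signs inside the row telescope to its two ends. Since the number of columns is odd, what is
    left cancels against the signs of the two boundary weights. *)
Lemma Zup_opp x us v : Zup (- x :: us) v = Zup (x :: us) v.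
Proof.
rewrite /Zup.
have E y : nseq (size (y :: us)).*2.+1 true = true :: rcons (nseq (size us).*2.+1 true) true.
  by rewrite -cats1 -(nseqD _ 1) addn1.
rewrite !E !Zword_cons !sum_bool !rrow_rcons !sum_bool !sites_opp size_cat /= size_rev addnS addnn.
rewrite exprS -mul2n exprM sqrrN expr1n expr1n /lw /rw /left_weight /right_weight.
by rewrite invrN !mulrN !sigmaN /sgn /=; ring.
Qed.

Lemma bw_inv u l r t b : bw u^-1 l r t b = bw u (~~ r) (~~ l) t b.
Proof. by rewrite /bw /bulk_weight invrK; case: l r t b => [] [] [] []. Qed.

Lemma sites_inv x cs l r f w : size w = size cs ->
  row (sites x^-1 [seq c^-1 | c <- cs]) l r f w =
  row (sites x (rev cs)) (~~ r) (~~ l) (fun b => f (rev b)) (rev w).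
Proof.
elim: cs l f w => [|c cs IH] l f [|t w] //=.
  by move=> _; rewrite eq_sym; case: l r => [] [].
move=> [sz]; rewrite !rev_cons /sites map_rcons row_rcons ?size_map ?size_rev //.
rewrite (reindex_inj (h := fun p : bool * bool => (~~ p.1, p.2))) /=; last first.
  by move=> [[] []] [[] []].
apply: eq_bigr => p _; rewrite -invfM bw_inv negbK IH // negbK; congr (_ * _).
by apply: eq_row => b _; rewrite rev_rcons.
Qed.

(** Inverting the parameters amounts to reflecting the triangle in its central column: the bulk
    weights are preserved and the left and right boundary weights are interchanged. *)
Lemma Zword_inv us v w : size w = (size us).*2.+1 ->
  Zword [seq u^-1 | u <- us] v^-1 w = Zword us v (rev w).
Proof.
elim: us w => // x us IH [|t w] //=; case/lastP: w => // w t'.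
rewrite size_rcons => -[sz]; rewrite rev_cons rev_rcons /=.
have szc : size w = size (us ++ v :: rev us) by rewrite sz size_cat /= size_rev addnS addnn.
under eq_bigr do rewrite rrow_rcons mulr_sumr.
under [RHS]eq_bigr do rewrite rrow_rcons mulr_sumr.
rewrite exchange_big (reindex_inj (inv_inj negbK)); apply: eq_bigr => l _ /=.
rewrite (reindex_inj (inv_inj negbK)); apply: eq_bigr => r _ /=.
have -> : [seq u^-1 | u <- us] ++ v^-1 :: rev [seq u^-1 | u <- us] =
    [seq u^-1 | u <- us ++ v :: rev us] by rewrite map_cat /= map_rev.
have pal : rev (us ++ v :: rev us) = us ++ v :: rev us.
  by rewrite rev_cat rev_cons revK cat_rcons.
rewrite sites_inv ?pal // !negbK mulrCA.
have -> : lw x^-1 t (~~ r) = rw x t r by [].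
have -> : rw x^-1 t' (~~ l) = lw x t' l.
  by rewrite /lw /rw /left_weight /right_weight negbK invrK.
congr (_ * (_ * _)); apply: eq_row => b.
by rewrite size_sites => szb; rewrite IH ?revK // size_rev szb -szc sz.
Qed.

Lemma Zup_inv us v : Zup [seq u^-1 | u <- us] v^-1 = Zup us v.
Proof. by rewrite /Zup size_map Zword_inv ?size_nseq // rev_nseq. Qed.

(** * The degree in the last parameter *)

(** Laurent polynomial functions of v with exponents between -n and n. *)
Definition laurent (n : nat) (g : F -> F) :=
  exists2 p : {poly F}, (size p <= n.*2.+1)%N & forall v, v != 0 -> v ^+ n * g v = p.[v].

Lemma laurent_eq n (g h : F -> F) : g =1 h -> laurent n g -> laurent n h.
Proof. by move=> gh [p sp pE]; exists p => // v v0; rewrite -gh pE. Qed.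

Lemma laurent0 n : laurent n (fun=> 0).
Proof. by exists 0; rewrite ?size_poly0 // => v _; rewrite mulr0 horner0. Qed.

Lemma laurent1 : laurent 0 (fun=> 1).
Proof. by exists 1; rewrite ?size_poly1 // => v _; rewrite mulr1 hornerC. Qed.

Lemma laurentD n (g h : F -> F) : laurent n g -> laurent n h -> laurent n (fun v => g v + h v).
Proof.
move=> [p sp pE] [r sr rE]; exists (p + r).
  by rewrite (leq_trans (size_polyD _ _)) // geq_max sp.
by move=> v v0; rewrite mulrDr hornerD pE ?rE.
Qed.

Lemma laurentZ n (g : F -> F) c : laurent n g -> laurent n (fun v => c * g v).
Proof.
move=> [p sp pE]; exists (c *: p); first by rewrite (leq_trans (size_scale_leq _ _)).
by move=> v v0; rewrite mulrCA hornerZ pE.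
Qed.

Lemma laurent_sum (I : finType) n (g : I -> F -> F) :
  (forall i, laurent n (g i)) -> laurent n (fun v => \sum_i g i v).
Proof.
move=> h; elim: (index_enum I) => [|i s IH].
  by apply: laurent_eq (laurent0 n) => v; rewrite big_nil.
by apply: laurent_eq (laurentD (h i) IH) => v; rewrite big_cons.
Qed.

Lemma laurentM m n (g h : F -> F) : laurent m g -> laurent n h -> laurent (m + n) (fun v => g v * h v).
Proof.
move=> [p sp pE] [r sr rE]; exists (p * r).
  by rewrite doubleD (leq_trans (size_polyMleq _ _)) // -subn1 leq_subLR (leq_trans (leq_add sp sr)) // addSn addnS.
by move=> v v0; rewrite exprD mulrACA hornerM pE ?rE.
Qed.

Lemma laurent_bw x l r t b : laurent 1 (fun v => bw (x * v) l r t b).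
Proof.
have l1 : laurent 1 (fun=> 1).
  by exists 'X; rewrite ?size_polyX // => v _; rewrite hornerX mulr1.
have ls (c d : F) : laurent 1 (fun v => c * v + d * v^-1).
  exists (c *: 'X^2 + d%:P).
    rewrite (leq_trans (size_polyD _ _)) // geq_max (leq_trans (size_scale_leq _ _)) ?size_polyXn //.
    by rewrite (leq_trans (size_polyC_leq1 _)).
  by move=> v v0; rewrite hornerD hornerZ hornerXn hornerC expr1; field.
have la : laurent 1 (fun v => sigma (q ^+ 2 * (x * v)) / sigma (q ^+ 4)).
  apply: laurent_eq (ls (q ^+ 2 * x / sigma (q ^+ 4)) (- (q ^+ 2 * x)^-1 / sigma (q ^+ 4))) => v.
  by rewrite /sigma mulrA (invfM _ v); ring.
have lb : laurent 1 (fun v => sigma (q ^+ 2 * (x * v)^-1) / sigma (q ^+ 4)).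
  apply: laurent_eq (ls (- (q ^+ 2 / x)^-1 / sigma (q ^+ 4)) (q ^+ 2 / x / sigma (q ^+ 4))) => v.
  by rewrite /sigma (invfM x) mulrA (invfM _ v^-1) invrK; ring.
by case: l r t b => [] [] [] [];
  [exact: la|exact: laurent0|exact: laurent0|exact: lb|exact: laurent0|exact: l1|exact: laurent0
  |exact: laurent0|exact: laurent0|exact: laurent0|exact: l1|exact: laurent0|exact: lb
  |exact: laurent0|exact: laurent0|exact: la].
Qed.

Lemma laurent_row n S l r (f : F -> bitseq -> F) w :
  (forall b, laurent n (f^~ b)) -> laurent n (fun v => row S l r (f v) w).
Proof.
elim: S l f w => [|s S IH] l f [|t w] h /=; try exact: laurent0.
  by case: eqP => _ //; exact: laurent0.
by apply: laurent_sum => p; apply: laurentZ; apply: (IH _ (fun v b => f v (p.2 :: b))).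
Qed.

Lemma laurent_row_center n x cs1 cs2 l r (f : F -> bitseq -> F) w :
  (forall b, laurent n (f^~ b)) ->
  laurent n.+1 (fun v => row (sites x (cs1 ++ v :: cs2)) l r (f v) w).
Proof.
elim: cs1 l f w => [|c cs1 IH] l f [|t w] h /=; try exact: laurent0.
  apply: laurent_sum => p; rewrite -add1n; apply: laurentM; first exact: laurent_bw.
  by apply: (laurent_row _ _ _ (f := fun v b => f v (p.2 :: b))).
by apply: laurent_sum => p; apply: laurentZ; apply: (IH _ (fun v b => f v (p.2 :: b))).
Qed.

(** Only the central column depends on v. It has one vertex in each row, whose weight has exponents
    between -1 and 1. *)
Lemma laurent_Zword us w : laurent (size us) (fun v => Zword us v w).
Proof.
elim: us w => [|x us IH] w /=; first exact: laurent1.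
case: w => [|t [|t' w]]; first exact: laurent0.
  apply: laurent_sum => l; apply: laurentZ; exact: laurent0.
apply: laurent_sum => l; apply: laurentZ; apply: laurent_sum => r; apply: laurentZ.
exact: (laurent_row_center _ _ _ _ _ _ (f := fun v b => Zword us v b)).
Qed.

End SixVertex.

(** * Schur polynomials *)

Section Alternants.
Variable F : fieldType.
Implicit Types (xs ys : seq F) (e : nat -> nat).

Definition alt k e xs : F := alternant (fun j : 'I_k => e j) (fun i : 'I_k => xs`_i).

Lemma eq_alt k e e' xs : (forall j, (j < k)%N -> e j = e' j) -> alt k e xs = alt k e' xs.
Proof.
by move=> h; rewrite /alt /alternant; congr (\det _); apply/matrixP => i j; rewrite !mxE h.
Qed.

(** The permutation is found before the exponents are chosen, so that the signs of two alternants
    cancel in their quotient. *)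
Lemma alt_perm k e xs ys : size xs = k -> perm_eq xs ys ->
  exists s : 'S_k, forall e, alt k e xs = (-1) ^+ s * alt k e ys.
Proof.
move=> sx p; have sy : size ys == k by rewrite -(perm_size p) sx.
have /tuple_permP[s xsE] : perm_eq xs (Tuple sy) by [].
exists s => {}e; rewrite /alt /alternant -det_perm -det_mulmx -row_permE; congr (\det _).
apply/matrixP => i j; rewrite !mxE xsE.
by rewrite (nth_map i) ?size_enum_ord // nth_ord_enum (tnth_nth 0).
Qed.

Lemma alt_dup k e xs (i j : 'I_k) : i != j -> xs`_i = xs`_j -> alt k e xs = 0.
Proof.
by move=> ij eqx; apply: (determinant_alternate ij) => a; rewrite !mxE eqx.
Qed.

(* Subtracting y times column j + r from column j turns x ^ (e j) into
   (x ^ d - y) x ^ (e (j + r)), which vanishes on the last r rows. *)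
Lemma alt_cat k r d e xs ys (y : F) : size xs = k -> size ys = r ->
  (forall j, (j < k)%N -> e j = (e (j + r) + d)%N) -> (forall x, x \in ys -> x ^+ d = y) ->
  (0 < r)%N ->
  alt (k + r) e (xs ++ ys) =
  (\prod_(x <- xs) (x ^+ d - y)) * alt k (fun j => e (j + r)%N) xs *
  alt r (fun j => e (k + j)%N) ys.
Proof.
move=> sx sy ed yd r0; rewrite /alt /alternant; set M := \matrix_(i, j) _.
pose T : 'M[F]_(k + r) := \matrix_(i, j) ((i == j)%:R - y * (i == (j + r)%N :> nat)%:R).
have detT : \det T = 1.
  rewrite det_trig; first by rewrite big1 // => i _; rewrite !mxE eqxx; case: eqP => [|_]; [lia|rewrite mulr0 subr0].
  apply/is_trig_mxP => i j ij; rewrite !mxE -val_eqE /= (_ : (i == j :> nat) = false); last lia.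
  by rewrite (_ : (i == j + r :> nat)%N = false) ?mulr0 ?subr0 //; lia.
rewrite -[LHS]mulr1 -[X in _ * X = _]detT -det_mulmx -[M *m T]submxK.
have MT i j : (M *m T) i j = if (j < k)%N then ((xs ++ ys)`_i ^+ d - y) * (xs ++ ys)`_i ^+ e (j + r)%N
                             else (xs ++ ys)`_i ^+ e j.
  rewrite mxE (bigD1 j) //= !mxE eqxx; have -> : (j == j + r :> nat)%N = false by lia.
  rewrite mulr0 subr0 mulr1; case: ltnP => jk.
    have jr : (j + r < k + r)%N by rewrite ltn_add2r.
    rewrite (bigD1 (Ordinal jr)) ?big1 /=; last by rewrite -val_eqE /=; lia.
      rewrite !mxE -val_eqE /= eqxx (_ : (j + r == j)%N = false); last lia.
      by rewrite ed // exprD addr0 mulr0n mulr1n; ring.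
    move=> i0 /andP[i0j]; rewrite !mxE -val_eqE /= => i0jr.
    by rewrite (negPf i0j) (negPf i0jr) mulr0 subr0 mulr0.
  rewrite big1 ?addr0 // => i0 i0j; rewrite !mxE (negPf i0j) (_ : (i0 == j + r :> nat)%N = false).
    by rewrite mulr0 subr0 mulr0.
  by have := ltn_ord i0; lia.
have -> : dlsubmx (M *m T) = 0.
  apply/matrixP => i j; rewrite [LHS]mxE [LHS]mxE MT /= ltn_ord nth_cat sx ltnNge leq_addr /=.
  by rewrite addKn yd ?subrr ?mul0r ?mxE // mem_nth ?sy.
rewrite det_ublock; congr (_ * _); last first.
  congr (\det _); apply/matrixP => i j; rewrite [LHS]mxE [LHS]mxE MT /= ltnNge leq_addr /=.
  by rewrite nth_cat sx ltnNge leq_addr /= addKn mxE.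
have -> : ulsubmx (M *m T) = diag_mx (\row_i (xs`_i ^+ d - y)) *m
    \matrix_(i < k, j < k) xs`_i ^+ e (j + r)%N.
  apply/matrixP => i j; rewrite mul_diag_mx [LHS]mxE [LHS]mxE MT /= ltn_ord nth_cat sx ltn_ord.
  by rewrite !mxE.
rewrite det_mulmx det_diag; congr (_ * _); rewrite [RHS](big_nth 0) sx big_mkord.
by apply: eq_bigr => i _; rewrite mxE.
Qed.

(** Expansion along the last row. Its cofactors do not involve w, so they can be taken at w = 0. *)
Lemma alt_last k e xs : size xs = k ->
  exists c : 'I_k.+1 -> F, forall w, alt k.+1 e (rcons xs w) = \sum_j c j * w ^+ e j.
Proof.
move=> sx; pose M w := \matrix_(i < k.+1, j < k.+1) (rcons xs w)`_i ^+ e j.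
exists (fun j => cofactor (M 0) ord_max j) => w.
rewrite /alt /alternant (expand_det_row _ ord_max); apply: eq_bigr => j _.
rewrite mxE nth_rcons sx ltnn eqxx mulrC; congr (_ * _); rewrite /cofactor; congr (_ * \det _).
by apply/matrixP => i j'; rewrite !mxE /= /bump leqNgt ltn_ord /= !nth_rcons sx ltn_ord.
Qed.

Definition vdm xs : F := alt (size xs) (fun j => size xs - j.+1)%N xs.

(** The case d = r = 1 of [alt_cat]. *)
Lemma vdm_rcons xs w : vdm (rcons xs w) = (\prod_(x <- xs) (x - w)) * vdm xs.
Proof.
rewrite /vdm size_rcons -addn1 -cats1 (@alt_cat _ 1 1 _ _ _ w) //.
- rewrite [alt 1 _ _](_ : _ = 1) ?mulr1; last first.
    by rewrite /alt /alternant det_mx11 mxE /= (_ : (_ - _)%N = 0%N) // addn0 addn1 subnn.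
  congr (_ * _); apply: eq_alt => j _; lia.
- move=> j jk; lia.
- by move=> x; rewrite inE => /eqP->.
Qed.

Lemma vdm_neq0 xs : uniq xs -> vdm xs != 0.
Proof.
elim/last_ind: xs => [|xs w IH]; first by rewrite /vdm /alt /alternant det_mx00 oner_eq0.
rewrite rcons_uniq vdm_rcons => /andP[wxs /IH v0]; rewrite mulf_neq0 // prodf_seq_neq0.
by apply/allP => x xxs /=; rewrite subr_eq0; apply: contraNneq wxs => <-.
Qed.

End Alternants.

(** * The Schur polynomial of lambda and its factorisation at cube roots of unity *)

Section SchurLambda.
Variable F : fieldType.
Implicit Types (xs ys : seq F).

Lemma nth_lambda n j : nth 0 (lambda n) j = (n - uphalf j)%N.
Proof.
case: n => [|m]; first by rewrite nth_nil.
case: j => [|j] //=; rewrite subSS.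
elim: m j => [|m IH] j; first by rewrite nth_nil.
have -> : iota 1 m.+1 = rcons (iota 1 m) m.+1 by rewrite -(addn1 m) iotaD add1n cats1 addn1.
by rewrite rev_rcons; case: j => [|[|j]] //=; rewrite IH subSS.
Qed.

(* The exponents in [0, 3n] congruent to 0 or 1 modulo 3, in decreasing order. *)
Definition expo n j := (nth 0 (lambda n) j + (n.*2 - j))%N.

Definition snum n xs : F := alt n.*2.+1 (expo n) xs.
Definition schl n xs : F := snum n xs / vdm xs.

Lemma schl_perm n xs ys : size xs = n.*2.+1 -> perm_eq xs ys -> schl n xs = schl n ys.
Proof.
move=> sx p; have [s h] := alt_perm (fun=> 0) sx p.
rewrite /schl /snum /vdm -(perm_size p) sx !h.
rewrite -mulf_div divff ?mul1r //; first by rewrite expf_neq0 // oppr_eq0 oner_eq0.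
Qed.

Lemma expoS n j : (j < n.*2.+1)%N -> expo n.+1 j = (expo n.+1 (j + 2) + 3)%N.
Proof. rewrite /expo !nth_lambda; lia. Qed.

Lemma expo2 n j : expo n.+1 (j + 2) = expo n j.
Proof. rewrite /expo !nth_lambda; lia. Qed.

(** The exponents drop by 3 every two columns, and y and w y have the same cube, so [alt_cat]
    applies with d = 3 and r = 2. The denominator takes the factors x - y and x - w y of x^3 - y^3,
    which leaves x - w^2 y. *)
Lemma schl_cube (w y : F) n xs : w ^+ 2 + w + 1 = 0 -> w != 1 -> y != 0 ->
  size xs = n.*2.+1 -> uniq xs -> y \notin xs -> w * y \notin xs ->
  schl n.+1 (xs ++ [:: y; w * y]) = (\prod_(x <- xs) (x - w ^+ 2 * y)) * schl n xs.
Proof.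
move=> w3 w1 y0 sx /vdm_neq0 nz4 yx wyx; rewrite /schl /snum.
have -> : (n.+1.*2.+1 = n.*2.+1 + 2)%N by lia.
rewrite (@alt_cat _ _ _ 3 _ _ _ (y ^+ 3)) //; first last.
- move=> x; rewrite !inE => /orP[] /eqP-> //; rewrite exprMn.
  have -> : w ^+ 3 = 1 by apply/subr0_eq; rewrite -(mulr0 (w - 1)) -w3; ring.
  by rewrite mul1r.
- by move=> j jn; apply: expoS.
rewrite [alt 2 _ _](_ : _ = y - w * y); last first.
  transitivity (vdm (rcons (rcons [::] y) (w * y))); last first.
    rewrite !vdm_rcons big_seq1 big_nil mul1r /vdm /alt /alternant det_mx00; ring.
  by apply: eq_alt => j; rewrite /expo !nth_lambda /=; lia.
have -> : alt n.*2.+1 (fun j => expo n.+1 (j + 2)) xs = alt n.*2.+1 (expo n) xs.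
  by apply: eq_alt => j _; exact: expo2.
rewrite -(cat_rcons y xs) cats1 !vdm_rcons big_rcons /=.
have -> : \prod_(x <- xs) (x ^+ 3 - y ^+ 3) = (\prod_(x <- xs) (x - w * y)) *
   (\prod_(x <- xs) (x - y)) * \prod_(x <- xs) (x - w ^+ 2 * y).
  rewrite -!big_split /=; apply: eq_bigr => x _; apply/subr0_eq.
  have -> : x ^+ 3 - y ^+ 3 = (x - w * y) * (x - y) * (x - w ^+ 2 * y) +
      (w ^+ 2 + w + 1) * y * (x ^+ 2 - w * x * y + (w - 1) * y ^+ 2) by ring.
  by rewrite w3 !mul0r addr0 subrr.
have nz1 : \prod_(x <- xs) (x - w * y) != 0.
  rewrite prodf_seq_neq0; apply/allP => x xxs /=; rewrite subr_eq0.
  by apply: contraNneq wyx => <-.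
have nz2 : \prod_(x <- xs) (x - y) != 0.
  rewrite prodf_seq_neq0; apply/allP => x xxs /=; rewrite subr_eq0.
  by apply: contraNneq yx => <-.
have nz3 : y - w * y != 0 by rewrite -{1}(mul1r y) -mulrBl mulf_neq0 // subr_eq0 eq_sym.
by field; rewrite nz1 nz2 nz3 nz4.
Qed.
End SchurLambda.

(** * The partition function at a primitive twelfth root of unity *)

Section SixthRoot.
Variables (F : fieldType) (q : F).
(** The twelfth cyclotomic polynomial vanishes at q, and 6 is invertible. *)
Hypotheses (q12 : q ^+ 4 - q ^+ 2 + 1 = 0) (two0 : 2%:R != 0 :> F) (three0 : 3%:R != 0 :> F).
Implicit Types (us xs : seq F) (u v x : F).

Lemma q6 : q ^+ 6 = -1.
Proof. by apply/subr0_eq; rewrite -(mul0r (q ^+ 2 + 1)) -q12; ring. Qed.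

Lemma q_neq0 : q != 0.
Proof.
by apply/eqP => q0; move: q6; rewrite q0 expr0n /= => /esym/eqP; rewrite oppr_eq0 oner_eq0.
Qed.

Lemma sigma_q_sqr : sigma q ^+ 2 = -1.
Proof.
apply/subr0_eq; rewrite -(mul0r (q ^- 2)) -q12 /sigma; field; exact: q_neq0.
Qed.

Lemma sigma_q_neq0 : sigma q != 0.
Proof.
by apply/eqP => s0; move: sigma_q_sqr; rewrite s0 expr0n /= => /esym/eqP; rewrite oppr_eq0 oner_eq0.
Qed.

Lemma q4E : q ^+ 4 = q ^+ 2 - 1.
Proof. by apply/subr0_eq; rewrite -q12; ring. Qed.

Lemma q4V : (q ^+ 4)^-1 = - q ^+ 2.
Proof.
have q40 : q ^+ 4 != 0 by rewrite expf_neq0 // q_neq0.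
by apply: (mulfI q40); rewrite divff // mulrN -exprD q6 opprK.
Qed.

Lemma sigma_q4_sqr : sigma (q ^+ 4) ^+ 2 = - 3%:R.
Proof.
rewrite /sigma q4V q4E; apply/subr0_eq; rewrite -(mulr0 4%:R) -q12; ring.
Qed.

Lemma sigma_q4_neq0 : sigma (q ^+ 4) != 0.
Proof.
apply/eqP => s0; move: sigma_q4_sqr; rewrite s0 expr0n /= => /esym/eqP.
by rewrite oppr_eq0 (negPf three0).
Qed.

(** * The right-hand side and generic parameters *)

Definition sqs us := flatten [seq [:: u ^+ 2; u ^- 2] | u <- us].
Definition sixths us := flatten [seq [:: u ^+ 6; u ^- 6] | u <- us].
(** Sixth powers are compared because the arguments to be kept apart differ by sixth roots of unity,
    and their squares by cube roots of unity. *)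
Definition generic us := all (predC1 0) us && uniq (sixths us).

(** The right-hand side of the theorem multiplied by v + 1 and by the power of 3. *)
Definition rhs us v : F :=
  v ^+ size us * schl (size us) (rcons (sqs us) (v ^- 2)) +
  v * v ^- size us * schl (size us) (rcons (sqs us) (v ^+ 2)).

Lemma size_sqs us : size (sqs us) = (size us).*2.
Proof. by elim: us => //= u us ->. Qed.

Lemma perm_flatten_map (T S : eqType) (g : T -> seq S) s t :
  perm_eq s t -> perm_eq (flatten [seq g a | a <- s]) (flatten [seq g a | a <- t]).
Proof. by move=> st; apply: perm_flatten; apply: perm_map. Qed.

Lemma generic_perm us us' : perm_eq us us' -> generic us = generic us'.
Proof.
by move=> p; rewrite /generic (perm_all _ p) (perm_uniq (perm_flatten_map _ p)).
Qed.

Lemma rhs_perm us us' v : perm_eq us us' -> rhs us v = rhs us' v.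
Proof.
move=> p; rewrite /rhs -(perm_size p).
have h w : perm_eq (rcons (sqs us) w) (rcons (sqs us') w).
  by rewrite -!cats1 perm_cat2r perm_flatten_map.
by congr (_ * _ + _ * _); apply: schl_perm (h _); rewrite size_rcons size_sqs.
Qed.

Lemma rhs_opp u us v : rhs (- u :: us) v = rhs (u :: us) v.
Proof. by rewrite /rhs /sqs /= !sqrrN. Qed.

Lemma perm_sqs_inv us : perm_eq (sqs [seq u^-1 | u <- us]) (sqs us).
Proof.
elim: us => //= u us IH; rewrite /sqs /= !exprVn invrK.
by rewrite -[_ :: _ :: flatten _]/([:: _; _] ++ _) -[X in perm_eq _ X]/([:: _; _] ++ _);
  apply: perm_cat => //; rewrite (perm_catC [:: _] [:: _]).
Qed.

(** The factor v^-1 reflects v^-1 + 1 = v^-1 (v + 1). *)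
Lemma rhs_inv us v : v != 0 -> rhs [seq u^-1 | u <- us] v^-1 = v^-1 * rhs us v.
Proof.
move=> v0; have h w : schl (size us) (rcons (sqs [seq u^-1 | u <- us]) w) = schl (size us) (rcons (sqs us) w).
  apply: schl_perm; first by rewrite size_rcons size_sqs size_map.
  by rewrite -!cats1 perm_cat2r perm_sqs_inv.
by rewrite /rhs size_map !h !exprVn !invrK; field; rewrite expf_neq0 ?v0.
Qed.

Lemma generic_cons u us : generic (u :: us) ->
  [/\ u != 0, u ^+ 6 != u ^- 6, u ^+ 6 \notin sixths us, u ^- 6 \notin sixths us & generic us].
Proof.
rewrite /generic /= inE negb_or => /andP[/andP[u0 us0] /and3P[/andP[u6 n1] n2 un]].
by split=> //; apply/andP.
Qed.

Lemma mem_sqs x us : x \in sqs us -> x ^+ 3 \in sixths us.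
Proof.
elim: us => //= u us IH; rewrite !inE => /or3P[/eqP->|/eqP->|/IH->]; rewrite ?orbT //.
  by rewrite -exprM eqxx.
by rewrite exprVn -exprM eqxx orbT.
Qed.

Lemma uniq_sqs us : generic us -> uniq (sqs us).
Proof.
elim: us => //= u us IH /generic_cons[u0 u6 n1 n2 /IH ->]; rewrite andbT inE negb_or -andbA.
apply/and3P; split.
- by apply: contraNneq u6 => /(congr1 (fun z => z ^+ 3)); rewrite exprVn -!exprM => /eqP.
- by apply: contraNN n1 => /mem_sqs; rewrite -exprM.
- by apply: contraNN n2 => /mem_sqs; rewrite exprVn -exprM.
Qed.

Lemma cubeP (w : F) : w ^+ 2 + w + 1 = 0 -> (w ^+ 3 = 1) * (w != 1).
Proof.
move=> w0; split; first by apply/subr0_eq; rewrite -(mulr0 (w - 1)) -w0; ring.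
by apply: contraNneq three0 => w1; rewrite -w0 w1; apply/eqP; ring.
Qed.

Lemma perm_move (T : eqType) (a b c : T) s :
  perm_eq (a :: b :: s ++ [:: c]) (rcons s b ++ [:: a; c]) /\
  perm_eq (a :: b :: s ++ [:: c]) (rcons s a ++ [:: b; c]).
Proof.
by split; apply/seq.permP => p; rewrite -cats1 !count_cat /= !count_cat /=;
  move: (count p s) (nat_of_bool (p a)) (nat_of_bool (p b)) (nat_of_bool (p c)) => n1 n2 n3 n4; lia.
Qed.

(** Among the variables are y, y^-1 and w y. The pair y, w y is moved to the end for [schl_cube],
    and y^-1 becomes the last variable of the smaller polynomial. *)
Lemma schl_pair (w y : F) us (x : F) : w ^+ 2 + w + 1 = 0 -> generic (x :: us) ->
  (y = x ^+ 2) \/ (y = x ^- 2) ->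
  schl (size us).+1 (rcons (sqs (x :: us)) (w * y)) =
  (\prod_(z <- rcons (sqs us) y^-1) (z - w ^+ 2 * y)) * schl (size us) (rcons (sqs us) y^-1).
Proof.
move=> w0 gx yx; have [w3 w1] := cubeP w0.
have [x0 x6 n1 n2 gus] := generic_cons gx.
have y0 : y != 0 by case: yx => ->; rewrite ?invr_eq0 expf_neq0.
have y3 : y ^+ 3 != y^-1 ^+ 3.
  by case: yx => ->; rewrite ?invrK !exprVn -!exprM // eq_sym.
have ny : y ^+ 3 \notin sixths us by case: yx => ->; rewrite ?exprVn -!exprM.
have nyV : y^-1 ^+ 3 \notin sixths us.
  by case: yx => ->; rewrite ?invrK ?exprVn -!exprM.
rewrite (@schl_perm _ _ _ (rcons (sqs us) y^-1 ++ [:: y; w * y])); last first.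
- rewrite -(cats1 _ (w * y)) /sqs /= -/(sqs us).
  by case: yx => ->; rewrite ?invrK; [exact: (perm_move _ _ _ _).1 | exact: (perm_move _ _ _ _).2].
- by rewrite size_rcons size_sqs.
apply: schl_cube => //; first by rewrite size_rcons size_sqs.
- by rewrite rcons_uniq uniq_sqs // andbT; apply: contraNN nyV => /mem_sqs.
- rewrite mem_rcons inE negb_or; apply/andP; split; first by apply: contraNneq y3 => {1}->.
  by apply: contraNN ny => /mem_sqs.
- rewrite mem_rcons inE negb_or; apply/andP; split.
    by apply: contraNneq y3 => <-; rewrite exprMn w3 mul1r.
  by apply: contraNN ny => /mem_sqs; rewrite exprMn w3 mul1r.
Qed.

(** * The identity cleared of denominators and its recursion *)

Definition tri n := (n * (n - 1) %/ 2)%N.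

Lemma triS n : tri n.+1 = (tri n + n)%N.
Proof.
rewrite /tri subn1 /=; case: n => // n; rewrite subn1 /=.
have -> : (n.+2 * n.+1 = n.+1 * 2 + n.+1 * n)%N by lia.
by rewrite divnMDl // addnC.
Qed.

Definition schur_id us v := 3%:R ^+ tri (size us) * (v + 1) * Zup q us v = rhs us v.

(** [Zup_recursion] reduces the left side to order n at x, and [schl_pair] does the same for both
    Schur terms on the right; the prefactors are then compared. *)
Lemma schur_id_rec x us : generic (x :: us) -> schur_id us x -> schur_id (x :: us) (q ^+ 2 / x).
Proof.
move=> gx IH; have [x0 x6 n1 n2 gus] := generic_cons gx.
have us0 : all (predC1 0) us by case/andP: gus.
have q0 := q_neq0; have q6E := q6.
rewrite /schur_id Zup_recursion // ?sigma_q_neq0 ?sigma_q4_neq0 //= triS exprD.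
set v := q ^+ 2 / x; set n := size us.
set A := schl n (rcons (sqs us) (x ^- 2)); set B := schl n (rcons (sqs us) (x ^+ 2)).
set K := \prod_(z <- sqs us) (z - q ^+ 4 * x ^+ 2).
(* The roots q^4 and q^8 are the two values of w: v^2 = q^4 x^-2 and v^-2 = q^8 x^2. *)
have w1 : (q ^+ 4) ^+ 2 + q ^+ 4 + 1 = 0.
  by rewrite -(mul0r (q ^+ 4 + q ^+ 2 + 1)) -q12; ring.
have w2 : (q ^+ 8) ^+ 2 + q ^+ 8 + 1 = 0.
  by rewrite -(mul0r ((q ^+ 4 + q ^+ 2 + 1) * (q ^+ 8 - q ^+ 4 + 1))) -q12; ring.
have -> : rhs (x :: us) v = v ^+ n.+1 * ((x ^- 2 - q ^+ 4 * x ^+ 2) * K * A) +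
    v * v ^- n.+1 * ((x ^+ 2 - q ^+ 8 * x ^- 2) * (K / (q ^+ 8 * x ^+ 4) ^+ n) * B).
  rewrite /rhs /= -/n.
  have -> : v ^- 2 = q ^+ 8 * x ^+ 2 by rewrite /v; field: q6E; rewrite ?q0 ?x0.
  have -> : v ^+ 2 = q ^+ 4 * x ^- 2 by rewrite /v; field; rewrite ?x0 ?q0.
  rewrite (schl_pair w2 gx) ?(schl_pair w1 gx); [|by right|by left].
  rewrite invrK -/A -/B -![rcons _ _]cats1 !big_cat !big_seq1 /=.
  have -> : (q ^+ 8) ^+ 2 = q ^+ 4 by field: q6E.
  have -> : (q ^+ 4) ^+ 2 = q ^+ 8 by ring.
  (* Since q^8 / x^2 is the inverse of q^4 x^2 and [sqs us] is stable under inversion, this product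
     is [K] up to one factor for each pair. *)
  have -> : \prod_(z <- sqs us) (z - q ^+ 8 / x ^+ 2) = K / (q ^+ 8 * x ^+ 4) ^+ n.
    rewrite /K /n; elim: (us) us0 => [|c s IHs] /=; first by rewrite !big_nil expr0 divr1.
    move=> /andP[c0 /IHs E]; rewrite !big_cons -/(sqs s) E (exprS _ (size s)).
    have : (q ^+ 8 * x ^+ 4) ^+ size s != 0 by rewrite !(expf_neq0, mulf_neq0).
    move: (_ ^+ size s) (\prod_(z <- _) _) => t p t0; field: q6E.
    by rewrite q0 x0 c0 t0.
  by rewrite -/K; ring.
have -> : 3%:R ^+ tri n * 3%:R ^+ n * (v + 1) *
   (sigma (q * x) / sigma q * (1 + sigma (q / x) / sigma q) *
    \prod_(c <- us) (sigma (q ^+ 2 * x * c) / sigma (q ^+ 4) *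
      (sigma (q ^+ 4 * c / x) / sigma (q ^+ 4))) * Zup q us x) =
   (v + 1) * (sigma (q * x) * (q / x - q^-1) / sigma q ^+ 2) * (- (q ^+ 4 * x ^+ 2)^-1) ^+ n * K
   * rhs us x.
  (* Each denominator sigma(q^4)^2 equals -3; these supply the n powers of 3 by which the two orders
     differ. *)
  have -> : \prod_(c <- us) (sigma (q ^+ 2 * x * c) / sigma (q ^+ 4) *
      (sigma (q ^+ 4 * c / x) / sigma (q ^+ 4))) = (- (q ^+ 4 * x ^+ 2)^-1) ^+ n * K / 3%:R ^+ n.
    rewrite /K /n; elim: (us) us0 => [|c s IHs] /=; first by rewrite !big_nil expr0 divr1 mulr1.
    move=> /andP[c0 /IHs E]; rewrite !big_cons -/(sqs s) E !(exprS _ (size s)).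
    have -> : sigma (q ^+ 2 * x * c) / sigma (q ^+ 4) * (sigma (q ^+ 4 * c / x) / sigma (q ^+ 4)) =
       - (q ^+ 4 * x ^+ 2)^-1 * (c ^+ 2 - q ^+ 4 * x ^+ 2) * (c ^- 2 - q ^+ 4 * x ^+ 2) / 3%:R.
      rewrite mulf_div -expr2 sigma_q4_sqr invrN /sigma; field: q6E.
      by rewrite three0 q0 x0 c0.
    by field; rewrite q0 x0 three0 c0 !expf_neq0.
  rewrite -IH -/n.
  (* The boundary factor contains the x + 1 of the induction hypothesis. *)
  have -> : 1 + sigma (q / x) / sigma q = (x + 1) * (q / x - q^-1) / sigma q.
    rewrite -[X in X + _](divff sigma_q_neq0) -mulrDl; congr (_ / _); rewrite /sigma; field.
    by rewrite ?x0 ?q0 ?x0.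
  by field; rewrite sigma_q_neq0 expf_neq0 // q0 x0.
have -> : (v + 1) * (sigma (q * x) * (q / x - q^-1) / sigma q ^+ 2) = v * (x ^- 2 - q ^+ 4 * x ^+ 2).
  by rewrite sigma_q_sqr invrN invr1 /v /sigma; field: q6E; rewrite ?x0 ?q0 ?x0.
have v0 : v != 0 by rewrite mulf_neq0 ?invr_eq0 ?expf_neq0.
have e1 : (- (q ^+ 4 * x ^+ 2)^-1) ^+ n * x ^+ n = v ^+ n.
  by rewrite -exprMn; congr (_ ^+ _); rewrite /v; field: q6E; rewrite ?x0 ?q0 ?x0.
have e2 : (- (q ^+ 4 * x ^+ 2)^-1) ^+ n * x ^- n = v ^- n / (q ^+ 8 * x ^+ 4) ^+ n.
  by rewrite -!exprVn -!exprMn; congr (_ ^+ _); rewrite /v; field: q6E; rewrite ?x0 ?q0 ?x0.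
rewrite /rhs -/n -/A -/B (exprS v) (invfM v).
transitivity (v * (x ^- 2 - q ^+ 4 * x ^+ 2) * K * (((- (q ^+ 4 * x ^+ 2)^-1) ^+ n * x ^+ n) * A +
   x * ((- (q ^+ 4 * x ^+ 2)^-1) ^+ n * x ^- n) * B)); first by ring.
rewrite e1 e2.
have -> : x ^+ 2 - q ^+ 8 * x ^- 2 = v * (x ^- 2 - q ^+ 4 * x ^+ 2) * x.
  by rewrite /v; field: q6E; rewrite x0.
by field; rewrite ?v0 ?x0 ?q0 ?expf_neq0 ?mulf_neq0 ?expf_neq0 ?invr_eq0.
Qed.

(** * Transport of the identity along the symmetries *)

Lemma schur_id_perm us us' v : perm_eq us us' -> Zup q us v = Zup q us' v ->
  schur_id us' v -> schur_id us v.
Proof. by rewrite /schur_id => p -> h; rewrite (perm_size p) h (rhs_perm _ p). Qed.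

Lemma schur_id_opp u us v : schur_id (- u :: us) v -> schur_id (u :: us) v.
Proof. by rewrite /schur_id Zup_opp rhs_opp. Qed.

Lemma schur_id_inv us v : v != 0 -> schur_id [seq u^-1 | u <- us] v^-1 -> schur_id us v.
Proof.
move=> v0; rewrite /schur_id Zup_inv rhs_inv // size_map => h.
by apply: (mulfI (invr_neq0 v0)); rewrite -h; field.
Qed.

Lemma sigma_neq0 x y : x ^+ 6 != y ^+ 6 -> y != 0 -> x != 0 -> sigma (q ^+ 4 * x / y) != 0.
Proof.
move=> xy y0 x0; have q0 := q_neq0.
have z0 : q ^+ 4 * x / y != 0 by rewrite !(mulf_neq0, expf_neq0, invr_eq0).
apply: contraNneq xy => /subr0_eq zV; have q6E := q6.
have z2 : (q ^+ 4 * x / y) ^+ 2 = 1 by rewrite expr2 {2}zV divff.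
have : (q ^+ 4 * x / y) ^+ 6 = 1 by rewrite (exprM _ 2 3) z2 expr1n.
have -> : (q ^+ 4 * x / y) ^+ 6 = x ^+ 6 / y ^+ 6 by field: q6E; rewrite y0.
by move=> h; apply/eqP/divr1_eq.
Qed.

Lemma mem_sixths x us : x \in us -> x ^+ 6 \in sixths us.
Proof.
by elim: us => //= u us IH; rewrite !inE => /orP[/eqP->|/IH->]; rewrite ?eqxx ?orbT.
Qed.

Lemma perm_sixths_inv us : perm_eq (sixths [seq u^-1 | u <- us]) (sixths us).
Proof.
elim: us => //= u us IH; rewrite /sixths /= !exprVn invrK.
by rewrite -[_ :: _ :: flatten _]/([:: _; _] ++ _) -[X in perm_eq _ X]/([:: _; _] ++ _);
  apply: perm_cat => //; rewrite (perm_catC [:: _] [:: _]).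
Qed.

Lemma generic_inv us : generic us -> generic [seq u^-1 | u <- us].
Proof.
case/andP=> us0 un; apply/andP; split; last by rewrite (perm_uniq (perm_sixths_inv us)).
by rewrite all_map; apply: sub_all us0 => u /=; rewrite invr_eq0.
Qed.

Lemma generic_opp u us : generic (u :: us) -> generic (- u :: us).
Proof.
have E : (- u) ^+ 6 = u ^+ 6 by rewrite (exprM _ 2 3) sqrrN -exprM.
by rewrite /generic /sixths /= oppr_eq0 E.
Qed.

Lemma schur_id_front us1 x us2 v : v != 0 -> generic (us1 ++ x :: us2) ->
  schur_id (x :: us1 ++ us2) v -> schur_id (us1 ++ x :: us2) v.
Proof.
move=> v0 gus; apply: schur_id_perm; first by rewrite -cat_rcons -cats1 -!catA perm_catCA.
have [us0 _] := andP gus.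
apply: (Zup_front q_neq0 sigma_q_neq0 sigma_q4_neq0) => //; apply/allP => y yus.
have pe : perm_eq (us1 ++ x :: us2) (x :: us1 ++ us2) by rewrite -cat_rcons -cats1 -!catA perm_catCA.
have [x0 _ n1 _ _] := generic_cons (etrans (esym (generic_perm pe)) gus).
apply: sigma_neq0 => //; last by apply: (allP us0); rewrite mem_cat yus.
by apply: contraNneq n1 => ->; apply: mem_sixths; rewrite mem_cat yus.
Qed.

(** Symmetry brings u to the front, where the recursion applies. For the minus sign u is first
    replaced by -u, by evenness. *)
Lemma schur_id_point us u : generic us -> u \in us ->
  (forall us', (size us' < size us)%N -> generic us' -> forall v, v != 0 -> v ^+ 2 \notin sqs us' ->
     schur_id us' v) ->
  schur_id us (q ^+ 2 / u) /\ schur_id us (- (q ^+ 2 / u)).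
Proof.
move=> gus /splitPr uus IH; case: uus gus IH => us1 us2 gus IH.
have pe : perm_eq (us1 ++ u :: us2) (u :: us1 ++ us2).
  by rewrite -cat_rcons -cats1 -!catA perm_catCA.
have gu : generic (u :: us1 ++ us2) by rewrite -(generic_perm pe).
have [u0 _ n1 _ gus'] := generic_cons gu.
have IHu w : w ^+ 2 = u ^+ 2 -> schur_id (us1 ++ us2) w.
  move=> wu; apply: IH => //; first by rewrite !size_cat /= addnS.
    by apply: contraNneq u0 => w0; move/esym/eqP: wu; rewrite w0 expr0n expf_eq0.
  by rewrite wu; apply: contraNN n1 => /mem_sqs; rewrite -exprM.
have q0 := q_neq0.
split; apply: schur_id_front => //.
- by rewrite mulf_neq0 ?expf_neq0 ?invr_eq0.
- by apply: schur_id_rec => //; apply: IHu.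
- by rewrite oppr_eq0 mulf_neq0 ?expf_neq0 ?invr_eq0.
- apply: schur_id_opp; rewrite -mulrN -invrN.
  by apply: schur_id_rec; [apply: generic_opp | apply: IHu; rewrite sqrrN].
Qed.

(** * Interpolation in the last parameter *)

Definition roots6 := [:: 1; -1; q ^+ 2; - q ^+ 2; q ^- 2; - q ^- 2].

(** Eight points for each u: +-u and +-1/u, where v^2 meets a variable of [sqs us], and the four
    points +-q^2/u, +-q^(-2)/u given by the recursion and the inversion. *)
Definition nodes us := flatten [seq [:: u; - u] ++ [seq z / u | z <- roots6] | u <- us].

Lemma roots6P z : z \in roots6 -> z ^+ 6 = 1.
Proof.
have q0 := q_neq0; have q6E := q6.
by rewrite !inE => /or4P[|||/or3P[]] /eqP->; rewrite ?expr1n //; field: q6E.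
Qed.

Lemma mem_node u x : u != 0 -> x \in [:: u; - u] ++ [seq z / u | z <- roots6] ->
  (x ^+ 6 == u ^+ 6) || (x ^+ 6 == u ^- 6).
Proof.
move=> u0; rewrite mem_cat => /orP[|/mapP[z /roots6P z6 ->]].
  by rewrite !inE => /orP[] /eqP->; rewrite ?eqxx // (exprM _ 2 3) sqrrN -exprM eqxx.
by rewrite exprMn z6 mul1r exprVn eqxx orbT.
Qed.

Lemma mem_nodes us x : all (predC1 0) us -> x \in nodes us -> x ^+ 6 \in sixths us.
Proof.
elim: us => //= u us IH /andP[u0 us0]; rewrite mem_cat => /orP[/(mem_node u0)|/(IH us0)].
  by rewrite !inE => /orP[]->; rewrite ?orbT.
by rewrite !inE => ->; rewrite !orbT.
Qed.

(** Sixth powers separate the nodes of different u, and also +-u from the points z/u. It remains to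
    see that the six roots of unity are distinct. *)
Lemma uniq_nodes us : generic us -> uniq (nodes us).
Proof.
have q0 := q_neq0; have q6E := q6.
have q2V : q ^- 2 = 1 - q ^+ 2.
  by apply: (mulfI (expf_neq0 2 q0)); rewrite divff ?expf_neq0 //; apply/subr0_eq; rewrite -q12; ring.
have uz : uniq roots6.
  have t0 : q ^+ 2 != 0 by rewrite expf_neq0.
  have t1 : 1 - q ^+ 2 != 0 by rewrite -q2V invr_eq0.
  have /andP[t2 t3] : (1 + q ^+ 2 != 0) && (2%:R - q ^+ 2 != 0).
    rewrite -negb_or -mulf_eq0 (_ : _ * _ = 3%:R) //.
    by apply/subr0_eq; rewrite -oppr0 -q12; ring.
  have t4 : 1 - 2%:R * q ^+ 2 != 0.
    have e : (1 - 2%:R * q ^+ 2) ^+ 2 = - 3%:R.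
      by apply/subr0_eq; rewrite -(mulr0 4%:R) -q12; ring.
    by apply: contraNneq three0 => h; rewrite -oppr_eq0 -e h expr0n.
  have ne (a b c : F) : a - b = c -> c != 0 -> a != b by move=> <-; rewrite subr_eq0.
  (* With q^-2 = 1 - q^2 each of the fifteen differences is, up to sign, a product of elements
     already known to be nonzero. *)
  rewrite /roots6 q2V /= !inE !negb_or !andbT; do !(apply/andP; split).
  - by apply: (ne _ _ 2%:R); [ring | rewrite ?oppr_eq0 ?mulf_neq0 ?oner_eq0].
  - by apply: (ne _ _ (1 - q ^+ 2)); [ring | rewrite ?oppr_eq0 ?mulf_neq0 ?oner_eq0].
  - by apply: (ne _ _ (1 + q ^+ 2)); [ring | rewrite ?oppr_eq0 ?mulf_neq0 ?oner_eq0].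
  - by apply: (ne _ _ (q ^+ 2)); [ring | rewrite ?oppr_eq0 ?mulf_neq0 ?oner_eq0].
  - by apply: (ne _ _ (2%:R - q ^+ 2)); [ring | rewrite ?oppr_eq0 ?mulf_neq0 ?oner_eq0].
  - by apply: (ne _ _ (- (1 + q ^+ 2))); [ring | rewrite ?oppr_eq0 ?mulf_neq0 ?oner_eq0].
  - by apply: (ne _ _ (- (1 - q ^+ 2))); [ring | rewrite ?oppr_eq0 ?mulf_neq0 ?oner_eq0].
  - by apply: (ne _ _ (- (2%:R - q ^+ 2))); [ring | rewrite ?oppr_eq0 ?mulf_neq0 ?oner_eq0].
  - by apply: (ne _ _ (- (q ^+ 2))); [ring | rewrite ?oppr_eq0 ?mulf_neq0 ?oner_eq0].
  - by apply: (ne _ _ (2%:R * q ^+ 2)); [ring | rewrite ?oppr_eq0 ?mulf_neq0 ?oner_eq0].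
  - by apply: (ne _ _ (- (1 - 2%:R * q ^+ 2))); [ring | rewrite ?oppr_eq0 ?mulf_neq0 ?oner_eq0].
  - by apply: (ne _ _ 1); [ring | rewrite ?oppr_eq0 ?mulf_neq0 ?oner_eq0].
  - by apply: (ne _ _ (-1)); [ring | rewrite ?oppr_eq0 ?mulf_neq0 ?oner_eq0].
  - by apply: (ne _ _ (1 - 2%:R * q ^+ 2)); [ring | rewrite ?oppr_eq0 ?mulf_neq0 ?oner_eq0].
  - by apply: (ne _ _ (2%:R * (1 - q ^+ 2))); [ring | rewrite ?oppr_eq0 ?mulf_neq0 ?oner_eq0].
elim: us => // u us IH gu; have [u0 u6 n1 n2 gus] := generic_cons gu.
change (uniq (([:: u; - u] ++ [seq z / u | z <- roots6]) ++ nodes us)).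
rewrite cat_uniq IH // andbT; apply/andP; split; last first.
  apply/hasPn => x /(mem_nodes (andP gus).1) xus; apply: contraNN n1 => /(mem_node u0).
  by case/orP => /eqP h; move: xus; rewrite h // (negPf n2).
rewrite cat_uniq (map_inj_uniq (mulIf (invr_neq0 u0))) uz andbT.
apply/andP; split.
  by rewrite cons_uniq mem_seq1 andbT -subr_eq0 opprK -mulr2n -(mulr_natl _ 2) mulf_neq0.
apply/hasPn => _ /mapP[z /roots6P z6 ->]; apply: contraNN u6; rewrite !inE.
have E : (z / u) ^+ 6 = u ^- 6 by rewrite exprMn z6 mul1r exprVn.
by rewrite -E => /orP[] /eqP->; rewrite // (exprM (- u) 2 3) sqrrN -exprM.
Qed.

Lemma size_nodes us : size (nodes us) = (8 * size us)%N.
Proof. by elim: us => //= u us; rewrite /nodes /= => ->; lia. Qed.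
Lemma expo_le n j : (expo n j <= 3 * n)%N.
Proof. rewrite /expo nth_lambda; lia. Qed.

Lemma size_mul_le (p r : {poly F}) a b :
  (size p <= a.+1)%N -> (size r <= b.+1)%N -> (size (p * r)%R <= (a + b).+1)%N.
Proof.
move=> pa rb; rewrite (leq_trans (size_polyMleq _ _)) // -subn1 leq_subLR.
by rewrite (leq_trans (leq_add pa rb)) // addSn addnS.
Qed.

Lemma size_prod_sqr (s : seq F) : (size (\prod_(z <- s) (z%:P - 'X^2 : {poly F}))%R <= (size s).*2.+1)%N.
Proof.
elim: s => [|z s IH]; first by rewrite big_nil size_poly1.
have h : (size (z%:P - 'X^2 : {poly F})%R <= 3)%N.
  rewrite (leq_trans (size_polyD _ _)) // geq_max size_polyN size_polyXn.
  by rewrite (leq_trans (size_polyC_leq1 _)).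
by rewrite big_cons (size_mul_le h IH).
Qed.

(** The two factors belonging to u^2 and u^-2 are exchanged by v -> 1/v, up to v^4. *)
Lemma vdm_inv us v : v != 0 -> generic us ->
  vdm (rcons (sqs us) (v ^- 2)) * v ^+ (4 * size us) = vdm (rcons (sqs us) (v ^+ 2)).
Proof.
move=> v0 /andP[us0 _]; rewrite !vdm_rcons mulrAC; congr (_ * _).
elim: us us0 => [|u us IH] /=; first by rewrite !big_nil mulr1.
case/andP=> u0 /IH E; rewrite !big_cons -/(sqs us) -E mulnS exprD.
move: (v ^+ (4 * _)) (\prod_(x <- _) _) => a b; by field; rewrite u0 v0.
Qed.

Lemma snum_mem us w : w \in sqs us -> snum (size us) (rcons (sqs us) w) = 0.
Proof.
move=> ws; have h : (index w (sqs us) < (size us).*2)%N by rewrite -size_sqs index_mem.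
apply: (@alt_dup _ _ _ _ (Ordinal (ltnW h : index w (sqs us) < (size us).*2.+1)%N) ord_max).
  by rewrite -val_eqE /= neq_ltn h.
by rewrite /= !nth_rcons size_sqs h ltnn eqxx nth_index.
Qed.

Lemma sqs_inv us w : w \in sqs us -> w^-1 \in sqs us.
Proof.
elim: us => //= u us IH; rewrite !inE => /or3P[/eqP->|/eqP->|/IH->]; rewrite ?orbT //.
  by rewrite eqxx orbT.
by rewrite invrK eqxx.
Qed.

Lemma node_neq0 us x : all (predC1 0) us -> x \in nodes us -> x != 0.
Proof.
move=> us0 /(mem_nodes us0) xs; apply: contraTneq xs => ->; rewrite expr0n /=.
elim: us us0 => //= u us IH /andP[u0 /IH us0]; rewrite !inE !negb_or.
by rewrite eq_sym expf_neq0 // eq_sym invr_eq0 expf_neq0.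
Qed.

Lemma schur_id_interpolate us v : (0 < size us)%N -> generic us ->
  (forall x, x \in nodes us -> x ^+ 2 \notin sqs us -> schur_id us x) ->
  v != 0 -> v ^+ 2 \notin sqs us -> schur_id us v.
Proof.
move=> n0 gus hn v0 vS; have us0 := (andP gus).1.
set n := size us; pose S := sqs us.
have [pZ spZ pZE] : laurent n (Zup q us) by exact: laurent_Zword.
have [c cE] := @alt_last F n.*2 (expo n) S (size_sqs us).
pose N1 : {poly F} := \sum_j c j *: 'X^(6 * n - (expo n j).*2).
pose N2 : {poly F} := \sum_j c j *: 'X^((expo n j).*2).
(* The difference of the two sides, multiplied by v^n and by the Vandermonde determinant at v^2. By
   [vdm_inv] the term with v^-2 gets the factor v^(6n), which clears its negative powers as all
   exponents are at most 3n. *)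
pose D := 3%:R ^+ tri n *: (('X + 1%:P) * pZ * (vdm S *: \prod_(z <- S) (z%:P - 'X^2))) - (N1 + 'X * N2).
have V2 x : vdm (rcons S (x ^+ 2)) = (vdm S *: \prod_(z <- S) (z%:P - 'X^2)).[x].
  by rewrite vdm_rcons hornerZ horner_prod mulrC; congr (_ * _); apply: eq_bigr => z _; rewrite !hornerE.
have N1E x : x != 0 -> N1.[x] = x ^+ (6 * n) * snum n (rcons S (x ^- 2)).
  move=> x0; rewrite /snum cE horner_sum mulr_sumr; apply: eq_bigr => j _.
  have le : ((expo n j).*2 <= 6 * n)%N by have := expo_le n j; lia.
  rewrite hornerZ hornerXn mulrCA; congr (_ * _).
  by rewrite -exprVn -exprM mul2n -{2}(subnK le) exprD -mulrA -exprMn divff // expr1n mulr1.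
have N2E x : N2.[x] = snum n (rcons S (x ^+ 2)).
  rewrite /snum cE horner_sum; apply: eq_bigr => j _.
  by rewrite hornerZ hornerXn -exprM mul2n.
have DE x : x != 0 -> D.[x] = 3%:R ^+ tri n * ((x + 1) * (x ^+ n * Zup q us x) * vdm (rcons S (x ^+ 2)))
    - (x ^+ (6 * n) * snum n (rcons S (x ^- 2)) + x * snum n (rcons S (x ^+ 2))).
  move=> x0; rewrite /D hornerD hornerN hornerZ hornerM hornerM !hornerD hornerX hornerC -V2 pZE //.
  by rewrite N1E // hornerM hornerX N2E.
have Dgen x : x != 0 -> x ^+ 2 \notin S ->
    D.[x] = x ^+ n * vdm (rcons S (x ^+ 2)) * (3%:R ^+ tri n * (x + 1) * Zup q us x - rhs us x) /\
    x ^+ n * vdm (rcons S (x ^+ 2)) != 0.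
  move=> x0 xS.
  have vd0 : vdm (rcons S (x ^+ 2)) != 0 by apply: vdm_neq0; rewrite rcons_uniq xS uniq_sqs.
  split; last by rewrite mulf_neq0 ?expf_neq0.
  rewrite DE // /rhs /schl -/n -/S.
  have vi := vdm_inv x0 gus; rewrite -/n -/S in vi.
  have vd1 : vdm (rcons S (x ^- 2)) != 0.
    by apply: contraNneq vd0 => h; rewrite -vi h mul0r.
  have e6 : x ^+ (6 * n) = x ^+ n * x ^+ n * x ^+ (4 * n) by rewrite -!exprD; congr (_ ^+ _); lia.
  rewrite e6 -vi; have xn0 : x ^+ n != 0 by rewrite expf_neq0.
  have x4n0 : x ^+ (4 * n) != 0 by rewrite expf_neq0.
  move: (x ^+ n) (x ^+ (4 * n)) xn0 x4n0 => a b a0 b0.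
  by field; rewrite a0 b0 vd1.
have Droot x : x \in nodes us -> root D x.
  move=> xn; have x0 := node_neq0 us0 xn.
  have [xS|xS] := boolP (x ^+ 2 \in S).
    have xS' : x ^- 2 \in S by apply: sqs_inv.
    rewrite /root DE // /n !snum_mem // vdm_rcons (big_rem _ xS) /= subrr !mul0r !mulr0 addr0 subr0.
    by [].
  rewrite /root; have [-> _] := Dgen x x0 xS; apply/eqP.
  by rewrite (hn x xn xS) subrr mulr0.
have D0 : D = 0.
  (* The size of [D] is at most 6n + 2, which does not exceed its 8n roots as n > 0. *)
  apply/eqP/negPn/negP => D0; have := max_poly_roots D0 (introT allP Droot) (uniq_nodes gus).
  rewrite size_nodes ltnNge => /negP; apply.
  have sN (e : 'I_n.*2.+1 -> nat) : (forall j, e j <= 6 * n)%N ->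
      (size (\sum_j c j *: 'X^(e j) : {poly F})%R <= (6 * n).+1)%N.
    move=> eb; rewrite (leq_trans (size_sum _ _ _)) //; apply/bigmax_leqP => j _.
    by rewrite (leq_trans (size_scale_leq _ _)) // size_polyXn ltnS.
  have s1 : (size N1 <= (6 * n).+1)%N by apply: sN => j; rewrite leq_subr.
  have s2 : (size N2 <= (6 * n).+1)%N by apply: sN => j; have := expo_le n j; lia.
  have s3 : (size ('X + 1%:P : {poly F})%R <= 2)%N by rewrite size_XaddC.
  have s4 := size_prod_sqr S; rewrite size_sqs -/n in s4.
  rewrite (leq_trans (size_polyD _ _)) // size_polyN geq_max; apply/andP; split.
    have s5 := leq_trans (size_scale_leq (vdm S) _) s4.
    rewrite (leq_trans (size_scale_leq _ _)) // (leq_trans (size_mul_le (size_mul_le s3 spZ) s5)) //.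
    by move: n0; rewrite -/n; lia.
  rewrite (leq_trans (size_polyD _ _)) // geq_max (leq_trans s1); last by move: n0; rewrite -/n; lia.
  have s5 : (size ('X : {poly F}) <= 2)%N by rewrite size_polyX.
  by rewrite (leq_trans (size_mul_le s5 s2)) //; move: n0; rewrite -/n; lia.
have [DE' nz] := Dgen v v0 vS; move: DE'; rewrite D0 horner0 => /esym/eqP.
by rewrite mulf_eq0 (negPf nz) subr_eq0 => /eqP.
Qed.
Lemma mem_sqs_sqr us u : u \in us -> (u ^+ 2 \in sqs us) * (u ^- 2 \in sqs us).
Proof.
move=> uus; have h : u ^+ 2 \in sqs us; last by split=> //; apply: sqs_inv.
by elim: us uus => //= u' us IH; rewrite !inE => /orP[/eqP->|/IH->]; rewrite ?eqxx ?orbT.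
Qed.

(** Strong induction on the number of parameters. For none, both sides are v + 1. *)
Lemma schur_id_generic us v : generic us -> v != 0 -> v ^+ 2 \notin sqs us -> schur_id us v.
Proof.
move: {2}(size us).+1 (ltnSn (size us)) => m; elim: m us v => // m IHm us v.
rewrite ltnS => le_m gus v0 vS.
have [us0|n0] := posnP (size us).
  rewrite (size0nil us0) /schur_id /rhs /Zup /tri /= expr0 mul1r mulr1.
  have e w : schl 0 [:: w] = 1.
    rewrite /schl (vdm_rcons [::]) big_nil /snum /vdm /alt /alternant det_mx11 det_mx00 mxE.
    by rewrite /expo /= expr0 mulr1 divr1.
  by rewrite !e expr0 invr1 !mulr1 mul1r addrC.
apply: schur_id_interpolate => // x xn xS.
have IH us' : (size us' < size us)%N -> generic us' -> forall w, w != 0 -> w ^+ 2 \notin sqs us' ->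
    schur_id us' w.
  by move=> lt gus' w w0 wS; apply: IHm => //; apply: leq_trans lt le_m.
have us0 := (andP gus).1.
have /flatten_mapP[u uus] := xn; have u0 : u != 0 := allP us0 u uus.
have [h1 h2] := mem_sqs_sqr uus; have [p1 p2] := schur_id_point gus uus IH.
(* These two points come from the preceding ones, applied to the inverted parameters. *)
have [p3 p4] : schur_id us (q ^- 2 / u) /\ schur_id us (- (q ^- 2 / u)).
  have ius : u^-1 \in [seq w^-1 | w <- us] by apply: map_f.
  have [|r1 r2] := schur_id_point (generic_inv gus) ius; first by rewrite size_map.
  have q0 := q_neq0.
  split; apply: schur_id_inv.
  - by rewrite !(mulf_neq0, expf_neq0, invr_eq0).
  - by rewrite invfM !invrK; rewrite invrK in r1.
  - by rewrite oppr_eq0 !(mulf_neq0, expf_neq0, invr_eq0).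
  - by rewrite invrN invfM !invrK; rewrite invrK in r2.
(* At the nodes +-u and +-1/u there is nothing to show, since their squares lie in [sqs us]. *)
rewrite mem_cat => /orP[|/mapP[z]].
  by rewrite !inE => /orP[] /eqP xE; move: xS; rewrite xE ?sqrrN h1.
rewrite !inE => /or4P[| | |/or3P[]] /eqP-> xE; rewrite {}xE ?mulNr // in xS *.
- by move: xS; rewrite exprMn expr1n mul1r exprVn h2.
- by move: xS; rewrite mul1r sqrrN exprVn h2.
Qed.
End SixthRoot.

(** * Configurations and edge states *)

(* (true, (i, j)) is the horizontal edge (i, j) -- (i, j + 1) and
   (false, (i, j)) the vertical edge (i - 1, j) -- (i, j); a state g gives the
   value true to the horizontal edges pointing right and to the vertical edges
   pointing up. *)
Definition edge : Type := bool * (nat * nat).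
Definition hor i j : edge := (true, (i, j)).
Definition ver i j : edge := (false, (i, j)).

Section Orientations.
Variable n : nat.
Implicit Types (C : {set grid n * grid n}) (g : edge -> bool) (v w : grid n).

Definition is_edge (e : edge) : bool :=
  if e.1 then has_hedge n e.2.1 e.2.2 else has_vedge n e.2.1 e.2.2.

(** The arc that an edge becomes when its value is [true]. *)
Definition edge_arc (e : edge) : grid n * grid n :=
  (vtx n e.2.1 e.2.2, if e.1 then vtx n e.2.1 e.2.2.+1 else vtx n e.2.1.-1 e.2.2).

Definition orient g : {set grid n * grid n} :=
  [set p | [|| right_nbr p.1 p.2 && g (hor p.1.1 p.1.2),
               right_nbr p.2 p.1 && ~~ g (hor p.2.1 p.2.2),
               below_nbr p.2 p.1 && g (ver p.1.1 p.1.2)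
             | below_nbr p.1 p.2 && ~~ g (ver p.2.1 p.2.2)]].

(** Two grid points are neighbours in at most one of the four ways, so the clauses of [orient] never
    conflict. *)
Lemma right_nbr_excl v w : right_nbr v w ->
  [/\ right_nbr w v = false, below_nbr v w = false & below_nbr w v = false].
Proof.
case/and3P => /eqP e1 /eqP e2 _; rewrite /right_nbr /below_nbr e1.
split; apply/negbTE; rewrite !negb_and ?(eq_sym w.2) -?val_eqE /= ?e2.
- by rewrite (_ : (_ == _.+2) = false) ?orbT //; lia.
- by rewrite (_ : (_ == _) = false) //; lia.
- by rewrite (_ : (_ == _) = false) //; lia.
Qed.

Lemma below_nbr_excl v w : below_nbr v w ->
  [/\ below_nbr w v = false, right_nbr v w = false & right_nbr w v = false].
Proof.
case/and3P => /eqP e1 /eqP e2 _; rewrite /right_nbr /below_nbr e1.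
split; apply/negbTE; rewrite !negb_and ?(eq_sym w.1) -?val_eqE /= ?e2.
- by rewrite (_ : (_ == _.+2) = false) ?orbT //; lia.
- by rewrite (_ : (_ == _) = false) //; lia.
- by rewrite (_ : (_ == _) = false) //; lia.
Qed.

Lemma orient_is_orientation g : is_orientation (orient g).
Proof.
apply/forallP => v; apply/forallP => w; rewrite /adj !inE /=.
case: (boolP (right_nbr v w)) => [/right_nbr_excl[-> -> ->]|_] /=.
  by rewrite !orbF; case: (g _).
case: (boolP (right_nbr w v)) => [/right_nbr_excl[_ -> ->]|_] /=.
  by rewrite !orbF; case: (g _).
case: (boolP (below_nbr v w)) => [/below_nbr_excl[-> _ _]|_] /=.
  by rewrite !orbF; case: (g _).
by case: (boolP (below_nbr w v)) => //= _; rewrite !orbF; case: (g _).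
Qed.

Lemma vtx_val v : vtx n v.1 v.2 = v.
Proof. by rewrite /vtx !inord_val; case: v. Qed.

Lemma edge_arc_hor v w : right_nbr v w -> edge_arc (hor v.1 v.2) = (v, w).
Proof.
case/and3P => /eqP e1 /eqP e2 _; rewrite /edge_arc /= vtx_val -e2 e1.
by rewrite -[in X in vtx _ X]e1 e1 vtx_val.
Qed.

Lemma edge_arc_ver v w : below_nbr w v -> edge_arc (ver v.1 v.2) = (v, w).
Proof. by case/and3P => /eqP e1 /eqP e2 _; rewrite /edge_arc /= vtx_val e2 -e1 vtx_val. Qed.

Lemma orientation_sym C v w : is_orientation C -> adj v w -> ((v, w) \in C) = ((w, v) \notin C).
Proof.
by move=> /forallP/(_ v)/forallP/(_ w) h a; move: h; rewrite a; case: (_ \in C); case: (_ \in C).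
Qed.

Lemma orientE C g : is_orientation C ->
  (forall e, is_edge e -> (edge_arc e \in C) = g e) -> C = orient g.
Proof.
move=> oC h; apply/setP => -[v w]; rewrite inE /=.
case: (boolP (right_nbr v w)) => [r|r'] /=.
  have [-> -> ->] := right_nbr_excl r; rewrite !orbF -h ?(edge_arc_hor r) //.
  by case/and3P: r.
case: (boolP (right_nbr w v)) => [r|r''] /=.
  have [_ -> ->] := right_nbr_excl r; rewrite !orbF -h; last by case/and3P: r.
  by rewrite (edge_arc_hor r) (orientation_sym oC (_ : adj v w)) // /adj r orbT.
case: (boolP (below_nbr w v)) => [r|s'] /=.
  have [-> _ _] := below_nbr_excl r; rewrite !orbF -h ?(edge_arc_ver r) //.
  by case/and3P: r.
case: (boolP (below_nbr v w)) => [r|s''] /=.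
  rewrite -h; last by case/and3P: r.
  by rewrite (edge_arc_ver r) (orientation_sym oC (_ : adj v w)) // /adj r !orbT.
move: oC => /forallP/(_ v)/forallP/(_ w).
by rewrite /adj (negPf r') (negPf r'') (negPf s') (negPf s'') => /negbTE.
Qed.

Lemma val_vtx i j : (i < n.+2)%N -> (j < n.*2.+2)%N ->
  ((vtx n i j).1 = i :> nat) * ((vtx n i j).2 = j :> nat).
Proof. by move=> hi hj; rewrite /vtx /= !inordK. Qed.

Lemma vtx_nbr_hor i j : has_hedge n i j -> right_nbr (vtx n i j) (vtx n i j.+1).
Proof.
move=> h; have [hi hj] : (i < n.+2)%N /\ (j.+1 < n.*2.+2)%N by move: h; rewrite /has_hedge; lia.
by rewrite /right_nbr /vtx /= !inordK ?h ?eqxx // ltnW.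
Qed.

Lemma vtx_nbr_ver i j : has_vedge n i j -> below_nbr (vtx n i.-1 j) (vtx n i j).
Proof.
move=> h; have [i0 [hi hj]] : (0 < i)%N /\ (i < n.+2)%N /\ (j < n.*2.+2)%N.
  by move: h; rewrite /has_vedge; lia.
rewrite /below_nbr /vtx /= !inordK ?h ?prednK ?eqxx //; lia.
Qed.

Lemma orient_arc g e : is_edge e -> (edge_arc e \in orient g) = g e.
Proof.
case: e => -[] [i j] h; rewrite inE /=.
  have r := vtx_nbr_hor h; have [-> -> ->] := right_nbr_excl r; rewrite r /= !orbF.
  by rewrite /vtx /= !inordK //; move: h; rewrite /is_edge /has_hedge /=; lia.
have r := vtx_nbr_ver h; have [-> -> ->] := below_nbr_excl r; rewrite r /= !orbF.
by rewrite /vtx /= !inordK //; move: h; rewrite /is_edge /has_vedge /=; lia.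
Qed.

Lemma orient_arcN g i j : has_hedge n i j ->
  ((vtx n i j.+1, vtx n i j) \in orient g) = ~~ g (hor i j).
Proof.
move=> h; rewrite (orientation_sym (orient_is_orientation g)) ?/adj ?(vtx_nbr_hor h) ?orbT //.
by rewrite (@orient_arc _ (hor i j)).
Qed.

End Orientations.

(** * Sums over orientations as sums over edge states *)

Section StateSums.
Variable F : fieldType.
Implicit Types (g : edge -> bool) (X Y : (edge -> bool) -> F) (s : seq edge).

Definition upd g (e : edge) (b : bool) : edge -> bool := fun e' => if e' == e then b else g e'.

Fixpoint sum_states s X g : F :=
  if s is e :: s' then \sum_b sum_states s' X (upd g e b) else X g.

Lemma eq_sum_states s X Y g :
  (forall g', (forall e, e \notin s -> g' e = g e) -> X g' = Y g') ->
  sum_states s X g = sum_states s Y g.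
Proof.
elim: s g => [|e s IH] g h /=; first exact: h.
apply: eq_bigr => b _; apply: IH => g' g'E; apply: h => e' e's.
by move: e's; rewrite inE negb_or => /andP[/negPf ne es]; rewrite g'E // /upd ne.
Qed.

Lemma sum_states_scale s X (c : F) g :
  sum_states s (fun g => c * X g) g = c * sum_states s X g.
Proof. by elim: s g => //= e s IH g; rewrite mulr_sumr; apply: eq_bigr => b _; rewrite IH. Qed.

Lemma sum_states_cat s1 s2 X g :
  sum_states (s1 ++ s2) X g = sum_states s1 (sum_states s2 X) g.
Proof. by elim: s1 g => //= e s IH g; apply: eq_bigr => b _; rewrite IH. Qed.

(** [done] lists the edges whose values are already prescribed by [g]. Splitting on one edge of [s]
    at a time ends with a single orientation. *)
Lemma sum_orientations n s done (X : {set grid n * grid n} -> F) g :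
  uniq (done ++ s) -> (forall e, is_edge n e = (e \in done ++ s)) ->
  \sum_(C | is_orientation C && all (fun e => (edge_arc n e \in C) == g e) done) X C =
  sum_states s (fun g => X (orient n g)) g.
Proof.
elim: s done g => [|e s IH] done g un ed /=.
  rewrite (big_pred1 (orient n g)) // => C; apply/andP/eqP => [[oC /allP h]|->].
    by apply: orientE => // e; rewrite ed cats0 => /h /eqP.
  split; first exact: orient_is_orientation.
  by apply/allP => e ein; rewrite orient_arc // ed cats0.
rewrite (partition_big (fun C : {set grid n * grid n} => edge_arc n e \in C) predT) //=; apply: eq_bigr => b _.
rewrite -(IH (rcons done e)); last 2 first.
- by rewrite cat_rcons.
- by move=> e'; rewrite ed cat_rcons.
apply: eq_bigl => C; rewrite -andbA all_rcons; congr (_ && _).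
rewrite /upd eqxx andbC; congr (_ && _); apply: eq_in_all => e' e'd.
case: (e' =P e) => // ee; move: un; rewrite cat_uniq /= negb_or -ee.
by rewrite e'd !andbF.
Qed.

End StateSums.

(** * The six-vertex rule at bulk vertices *)

Section Degrees.
Variables (n : nat).
Implicit Types (C : {set grid n * grid n}).

(** The weight is 0 at a vertex that breaks the six-vertex rule, so the sum in [Z] may be extended
    to all orientations with the prescribed top edges. *)
Lemma bulk_degrees (F : fieldType) (q u : F) C i j : is_orientation C -> is_bulk n i j ->
  W_bulk q C i j u != 0 -> indeg C (vtx n i j) = 2 /\ outdeg C (vtx n i j) = 2.
Proof.
move=> oC bij; have hij : [&& 1 <= i, i <= n, i < j & j < n.*2.+2 - i]%N.
  by move: bij; rewrite /is_bulk; lia.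
pose v := vtx n i j; pose L := vtx n i j.-1; pose R := vtx n i j.+1.
pose U := vtx n i.-1 j; pose D := vtx n i.+1 j.
have nR : right_nbr v R by apply: vtx_nbr_hor; rewrite /has_hedge; lia.
have nL : right_nbr L v.
  have -> : v = vtx n i j.-1.+1 by rewrite prednK //; lia.
  by apply: vtx_nbr_hor; rewrite /has_hedge; lia.
have nU : below_nbr U v by apply: vtx_nbr_ver; rewrite /has_vedge; lia.
have nD : below_nbr v D by apply: (@vtx_nbr_ver _ i.+1); rewrite /has_vedge; lia.
have vE : (v.1 = i :> nat) * (v.2 = j :> nat) by apply: val_vtx; lia.
have uq : uniq [:: L; R; U; D].
  rewrite /= !inE !negb_or !andbT -!pair_eqE /= -!val_eqE /= !inordK; lia.
have nb w : adj v w -> w \in [:: L; R; U; D].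
  have wE a b : w.1 = a :> nat -> w.2 = b :> nat -> w = vtx n a b by move=> <- <-; rewrite vtx_val.
  case/or4P => /and3P[/eqP e1 /eqP e2 _]; rewrite !inE.
  - by rewrite (wE i j.+1) ?eqxx ?orbT // -?e1 ?e2 ?vE.
  - have -> : w = L by apply: wE; [rewrite e1 vE | rewrite -vE e2].
    by rewrite eqxx.
  - by rewrite (wE i.+1 j) ?eqxx ?orbT // -?e1 ?e2 ?vE.
  have -> : w = U by apply: wE; [rewrite -vE e2 | rewrite e1 vE].
  by rewrite eqxx !orbT.
have deg (p : grid n -> bool) : (forall w, p w -> adj v w) ->
    #|[set w | p w]| = (p L + p R + p U + p D)%N.
  move=> hp; rewrite -(@eq_card _ (mem (filter p [:: L; R; U; D]))); last first.
    by move=> w; rewrite mem_filter inE; case: (boolP (p w)) => // /hp /nb ->.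
  rewrite (card_uniqP _) ?filter_uniq // size_filter /= addn0 !addnA //.
have aN w : (w, v) \in C -> adj v w.
  move=> wv; move: oC => /forallP/(_ w)/forallP/(_ v).
  by case: ifP => [|_]; [rewrite /adj; case/or4P => ->; rewrite ?orbT | rewrite wv].
have aO w : (v, w) \in C -> adj v w.
  by move=> wv; move: oC => /forallP/(_ v)/forallP/(_ w); case: ifP => // _; rewrite wv.
rewrite /indeg /outdeg (deg _ aN) (deg _ aO).
have sR : ((R, v) \in C) = ((v, R) \notin C).
  by apply: orientation_sym => //; rewrite /adj nR ?orbT.
have sL : ((v, L) \in C) = ((L, v) \notin C).
  by apply: orientation_sym => //; rewrite /adj nL ?orbT.
have sU : ((U, v) \in C) = ((v, U) \notin C).
  by apply: orientation_sym => //; rewrite /adj nU ?orbT.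
have sD : ((v, D) \in C) = ((D, v) \notin C).
  by apply: orientation_sym => //; rewrite /adj nD ?orbT.
rewrite sR sL sU sD /W_bulk /Defs.arc /bulk_weight -/v -/L -/R -/U -/D.
by case: ((L, v) \in C); case: ((v, R) \in C); case: ((v, U) \in C); case: ((D, v) \in C); rewrite /= ?eqxx.
Qed.
End Degrees.

(** * The edge states of one row *)

Section RowStates.
Variables (F : fieldType) (q : F).
Implicit Types (g : edge -> bool) (f : bitseq -> F).

(** The right and lower edge of each bulk vertex of row i, in the order in which [row] sums over
    them. *)
Definition strip i (ks : seq nat) := flatten [seq [:: hor i k; ver i.+1 k] | k <- ks].

Definition bulk_site x (c : nat -> F) g i j :=
  bw q (x * c j) (g (hor i j.-1)) (g (hor i j)) (g (ver i j)) (g (ver i.+1 j)).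

Lemma mem_strip e i ks : (e \in strip i ks) =
  ((e.1 && (e.2.1 == i)) || (~~ e.1 && (e.2.1 == i.+1))) && (e.2.2 \in ks).
Proof.
elim: ks => [|k ks IH] /=; first by rewrite andbF.
rewrite !inE IH; case: e {IH} => -[] [a b]; rewrite /hor /ver !xpair_eqE /=;
  by case: (a == _); case: (b == k) => //=; rewrite ?orbF ?orbT.
Qed.

Lemma uniq_strip i ks : uniq ks -> uniq (strip i ks).
Proof.
elim: ks => //= k ks IH /andP[kks /IH ->]; by rewrite inE !mem_strip /= (negPf kks) !andbF.
Qed.

(** Induction along the row. Column j is the last one already treated, and m bulk vertices remain
    before the right boundary vertex. *)
Lemma sum_strip i j m x c f g :
  sum_states (strip i (iota j.+1 m)) (fun g => (\prod_(k <- iota j.+1 m) bulk_site x c g i k) *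
      (rw q x (g (ver i (j + m).+1)) (g (hor i (j + m))) *
       f [seq g (ver i.+1 k) | k <- iota j.+1 m])) g =
  \sum_r rw q x (g (ver i (j + m).+1)) r *
    row [seq bw q (x * c k) | k <- iota j.+1 m] (g (hor i j)) r f
      [seq g (ver i k) | k <- iota j.+1 m].
Proof.
elim: m j f g => [|m IH] j f g /=.
  rewrite big_nil mul1r addn0 (bigD1 (g (hor i j))) //= eqxx big1 ?addr0 // => r /negPf.
  by rewrite eq_sym => ->; rewrite mulr0.
under [RHS]eq_bigr do rewrite mulr_sumr.
rewrite [RHS]exchange_big -(pair_bigA _ (fun a b => \sum_r rw q x (g (ver i (j + m.+1).+1)) r *
  (bw q (x * c j.+1) (g (hor i j)) a (g (ver i j.+1)) b *
    row [seq bw q (x * c k) | k <- iota j.+2 m] a r (fun bs => f (b :: bs))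
      [seq g (ver i k) | k <- iota j.+2 m]))) /=.
apply: eq_bigr => a _; apply: eq_bigr => b _.
set g' := upd _ _ b.
have out e : e \notin [:: hor i j.+1; ver i.+1 j.+1] -> g' e = g e.
  by rewrite !inE negb_or /g' /upd => /andP[/negPf-> /negPf->].
have ga : g' (hor i j.+1) = a by rewrite /g' /upd /= eqxx.
have gb : g' (ver i.+1 j.+1) = b by rewrite /g' /upd eqxx.
transitivity (bw q (x * c j.+1) (g (hor i j)) a (g (ver i j.+1)) b *
  sum_states (strip i (iota j.+2 m)) (fun g => (\prod_(k <- iota j.+2 m) bulk_site x c g i k) *
      (rw q x (g (ver i (j.+1 + m).+1)) (g (hor i (j.+1 + m))) *
       f (b :: [seq g (ver i.+1 k) | k <- iota j.+2 m]))) g').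
  rewrite -sum_states_scale; apply: eq_sum_states => h hE.
  have nin e : e.2.2 = j \/ e.2.2 = j.+1 -> h e = g' e.
    move=> ee; apply: hE; rewrite mem_strip negb_and orbC.
    by rewrite mem_iota; case: ee => ->; rewrite ?ltnn // ltnNge leqnSn.
  have h1 : h (hor i j.+1) = a by rewrite nin ?ga //; right.
  have h2 : h (ver i.+1 j.+1) = b by rewrite nin ?gb //; right.
  have h3 : h (hor i j) = g (hor i j).
    by rewrite nin; [apply: out; rewrite !inE !xpair_eqE; lia | left].
  have h4 : h (ver i j.+1) = g (ver i j.+1).
    by rewrite nin; [apply: out; rewrite !inE !xpair_eqE; lia | right].
  by rewrite big_cons {1}/bulk_site /= h1 h2 h3 h4 -mulrA addSnnS.
rewrite (IH _ (fun bs => f (b :: bs))) mulr_sumr; apply: eq_bigr => r _.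
rewrite mulrCA addSnnS ga; congr (_ * (_ * _)).
  by congr (rw _ _ _ _); apply: out; rewrite !inE !xpair_eqE; lia.
congr (row _ _ _ _ _); apply/eq_in_map => k; rewrite mem_iota => hk.
by apply: out; rewrite !inE !xpair_eqE; lia.
Qed.
End RowStates.

(** * The partition function as a composition of rows *)

Section PartitionFunction.
Variables (F : fieldType) (q : F) (n : nat) (u : nat -> F).
Implicit Types (g : edge -> bool) (f : bitseq -> F) (C : {set grid n * grid n}).

(** The number of bulk vertices of row i. *)
Let m i := (n.*2.+1 - i.*2)%N.
Let col j := u (minn j (n.*2.+2 - j)).

Definition row_edges i : seq edge := hor i i :: strip i (iota i.+1 (m i)).

Definition row_weight i g : F :=
  lw q (u i) (g (ver i i)) (g (hor i i)) *
  ((\prod_(k <- iota i.+1 (m i)) bulk_site q (u i) col g i k) *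
   rw q (u i) (g (ver i (i + m i).+1)) (g (hor i (i + m i)))).

Lemma sum_row i f g :
  sum_states (row_edges i) (fun g => row_weight i g * f [seq g (ver i.+1 k) | k <- iota i.+1 (m i)]) g =
  \sum_l lw q (u i) (g (ver i i)) l * \sum_r rw q (u i) (g (ver i (i + m i).+1)) r *
    row [seq bw q (u i * col k) | k <- iota i.+1 (m i)] l r f [seq g (ver i k) | k <- iota i.+1 (m i)].
Proof.
rewrite /=; apply: eq_bigr => l _; set g' := upd g _ l.
have out e : e != hor i i -> g' e = g e by rewrite /g' /upd => /negPf->.
have gl : g' (hor i i) = l by rewrite /g' /upd eqxx.
have := sum_strip q i i (m i) (u i) col f g'; rewrite gl => E.
transitivity (lw q (u i) (g (ver i i)) l * sum_states (strip i (iota i.+1 (m i)))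
  (fun g => (\prod_(k <- iota i.+1 (m i)) bulk_site q (u i) col g i k) *
      (rw q (u i) (g (ver i (i + m i).+1)) (g (hor i (i + m i))) *
       f [seq g (ver i.+1 k) | k <- iota i.+1 (m i)])) g').
  rewrite -sum_states_scale; apply: eq_sum_states => h hE; rewrite /row_weight.
  have nin e : e.2.2 = i -> h e = g' e.
    by move=> ee; apply: hE; rewrite mem_strip mem_iota ee ltnn andbF.
  by rewrite (nin (hor i i)) // (nin (ver i i)) // gl out // -!mulrA.
rewrite E; congr (_ * _); apply: eq_bigr => r _; rewrite out //; congr (_ * row _ _ _ _ _).
Qed.

(** Folding the columns by [minn] makes their parameters a palindrome centred at u_{n+1}. *)
Lemma columns a k : (a + k = n.+1)%N ->
  [seq col j | j <- iota a k.*2.+1] =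
  [seq u j | j <- iota a k] ++ u n.+1 :: rev [seq u j | j <- iota a k].
Proof.
move=> ak; have -> : k.*2.+1 = (k + (1 + k))%N by lia.
rewrite iotaD map_cat iotaD map_cat /=; congr (_ ++ _ :: _).
- by apply/eq_in_map => j; rewrite mem_iota /col => hj; congr u; lia.
- by rewrite /col; congr u; lia.
rewrite -map_rev; apply: (@eq_from_nth _ 0); first by rewrite !size_map size_rev !size_iota.
rewrite size_map size_iota => j jk; rewrite !(nth_map 0%N) ?size_rev ?size_iota //.
rewrite nth_rev ?size_iota // !nth_iota //; last lia.
by rewrite /col; congr u; lia.
Qed.

Definition rows_from i k := flatten [seq row_edges j | j <- iota i k].

Lemma mem_row_edges e i : (e \in row_edges i) =
  if e.1 then [&& e.2.1 == i, i <= e.2.2 & e.2.2 <= i + m i]%N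
  else [&& e.2.1 == i.+1, i < e.2.2 & e.2.2 <= i + m i]%N.
Proof.
rewrite inE mem_strip mem_iota; case: e => -[] [a b]; rewrite /hor !xpair_eqE /=; lia.
Qed.

Lemma mem_rows_from e i k : e \in rows_from i k -> (i + ~~ e.1 <= e.2.1)%N.
Proof.
case/flatten_mapP => j; rewrite mem_iota => hj; rewrite mem_row_edges.
by case: e.1; lia.
Qed.

(** Induction from the bottom: [k] counts the rows from row n + 1 - k downwards. *)
Lemma sum_rows k g : (k <= n)%N ->
  sum_states (rows_from (n.+1 - k) k) (fun g => \prod_(i <- iota (n.+1 - k) k) row_weight i g) g =
  Zword q [seq u i | i <- iota (n.+1 - k) k] (u n.+1)
    [seq g (ver (n.+1 - k) j) | j <- iota (n.+1 - k) k.*2.+1].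
Proof.
elim: k g => [|k IH] g kn; first by rewrite /= big_nil.
have := IH _ (ltnW kn); set i := (n.+1 - k.+1)%N.
have -> : (n.+1 - k)%N = i.+1 by rewrite /i; lia.
move=> {}IH; rewrite (_ : rows_from i k.+1 = row_edges i ++ rows_from i.+1 k) // sum_states_cat.
rewrite (_ : iota i k.+1 = i :: iota i.+1 k) // map_cons.
rewrite (_ : iota i k.+1.*2.+1 = i :: iota i.+1 k.+1.*2) // map_cons.
have mi : m i = k.*2.+1 by rewrite /m /i; lia.
transitivity (sum_states (row_edges i) (fun g => row_weight i g *
    Zword q [seq u i | i <- iota i.+1 k] (u n.+1) [seq g (ver i.+1 j) | j <- iota i.+1 (m i)]) g).
  apply: eq_sum_states => h _; rewrite mi -IH -sum_states_scale.
  apply: eq_sum_states => h' h'E; rewrite big_cons; congr (_ * _).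
  (* The edges at row i, including the vertical ones just below it, are left unchanged by the sum
     over the lower rows. *)
  have nin e : (e.2.1 < i.+1 + ~~ e.1)%N -> h' e = h e.
    by move=> he; apply: h'E; apply/negP => /mem_rows_from; rewrite leqNgt he.
  rewrite /row_weight !nin /=; try lia.
  congr (_ * (_ * _)); apply: eq_bigr => j _.
  by rewrite /bulk_site !nin //=; lia.
rewrite sum_row Zword_cons; apply: eq_bigr => l _; congr (_ * _).
have -> : iota i.+1 k.+1.*2 = rcons (iota i.+1 (m i)) (i + m i).+1.
  rewrite mi -cats1 -[[:: _]]/(iota _ 1) -addSn -iotaD; congr iota; lia.
rewrite map_rcons rrow_rcons; apply: eq_bigr => r _; congr (_ * row _ _ _ _ _).
by rewrite mi -columns ?/sites -?map_comp //; rewrite /i; lia.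
Qed.

Lemma uniq_rows_from i k : uniq (rows_from i k).
Proof.
elim: k i => // k IH i; rewrite (_ : rows_from i k.+1 = row_edges i ++ rows_from i.+1 k) //.
rewrite cat_uniq IH andbT; apply/andP; split.
  by rewrite /= uniq_strip ?iota_uniq // mem_strip mem_iota /= ltnn !andbF.
apply/hasPn => e /mem_rows_from; rewrite mem_row_edges.
by case: e.1 => /= le; apply/negP => /and3P[/eqP h _ _]; move: le; rewrite h; lia.
Qed.

Definition top_edges := [seq ver 1 j | j <- iota 1 n.*2.+1].

Lemma uniq_edges : uniq (top_edges ++ rows_from 1 n).
Proof.
rewrite cat_uniq uniq_rows_from andbT; apply/andP; split.
  by rewrite map_inj_uniq ?iota_uniq // => i j [].
by apply/hasPn => e /mem_rows_from; apply: contraTN => /mapP[j _ ->].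
Qed.

Lemma mem_edges e : is_edge n e = (e \in top_edges ++ rows_from 1 n).
Proof.
rewrite mem_cat; apply/idP/orP => [|[/mapP[j]|/flatten_mapP[k]]]; last 2 first.
- by rewrite mem_iota => hj ->; rewrite /is_edge /= /has_vedge; lia.
- rewrite mem_iota mem_row_edges /is_edge /has_vedge /has_hedge /m.
  by case: e => -[] [a b] /=; lia.
case: e => -[] [i j]; rewrite /is_edge /= => h.
  right; apply/flatten_mapP; exists i; first by move: h; rewrite mem_iota /has_hedge; lia.
  by rewrite mem_row_edges /=; move: h; rewrite /has_hedge /m; lia.
have [i1|i1] := eqVneq i 1%N.
  by left; apply/mapP; exists j; rewrite -?i1 //; move: h; rewrite mem_iota /has_vedge; lia.
right; apply/flatten_mapP; exists i.-1; first by move: h; rewrite mem_iota /has_vedge; lia.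
by rewrite mem_row_edges /=; move: h; rewrite /has_vedge /m; lia.
Qed.

Let weight C : F := \prod_(1 <= i < n.+1)
  (W_left q C i (u i) * (\prod_(i.+1 <= j < n.*2.+2 - i) W_bulk q C i j (u i * col j)) *
   W_right q C i (u i)).

Lemma weight_orient g : weight (orient n g) = \prod_(i <- iota 1 n) row_weight i g.
Proof.
rewrite /weight /index_iota subn1 /=; apply: eq_big_seq => i; rewrite mem_iota => hi.
have im : (i + m i = n.*2.+1 - i)%N by rewrite /m; lia.
rewrite /row_weight -mulrA; congr (_ * (_ * _)).
- rewrite /W_left /Defs.arc /lw; congr (left_weight _ _ _ _).
    by apply: (@orient_arc _ _ (ver i i)); rewrite /is_edge /= /has_vedge; lia.
  by apply: (@orient_arc _ _ (hor i i)); rewrite /is_edge /= /has_hedge; lia.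
- rewrite (_ : (n.*2.+2 - i - i.+1)%N = m i); last by rewrite /m; lia.
  apply: eq_big_seq => j; rewrite mem_iota => hj.
  rewrite /W_bulk /bulk_site /bw /Defs.arc; congr (bulk_weight _ _ _ _ _ _).
  + rewrite -[in X in (_, X)](prednK (_ : 0 < j)%N); last by lia.
    by apply: (@orient_arc _ _ (hor i j.-1)); rewrite /is_edge /= /has_hedge; lia.
  + by apply: (@orient_arc _ _ (hor i j)); rewrite /is_edge /= /has_hedge; lia.
  + by apply: (@orient_arc _ _ (ver i j)); rewrite /is_edge /= /has_vedge; lia.
  + by apply: (@orient_arc _ _ (ver i.+1 j)); rewrite /is_edge /= /has_vedge; lia.
rewrite /W_right /Defs.arc /rw im (_ : (n.*2.+2 - i)%N = (n.*2.+1 - i).+1); last by lia.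
congr (right_weight _ _ _ _).
  by apply: (@orient_arc _ _ (ver i _)); rewrite /is_edge /= /has_vedge; lia.
by apply: orient_arcN; rewrite /has_hedge; lia.
Qed.

Lemma top_edgesE C : all (fun e => (edge_arc n e \in C) == true) top_edges =
  [forall j : 'I_n.*2.+2, (1 <= j <= n.*2.+1)%N ==> ((vtx n 1 j, vtx n 0 j) \in C)].
Proof.
rewrite all_map; apply/allP/forallP => h j.
  apply/implyP => hj; apply/eqP; have := h j; rewrite mem_iota /= => -> //; lia.
rewrite mem_iota => hj; have jn : (j < n.*2.+2)%N by lia.
by have /implyP := h (Ordinal jn); rewrite /= => -> //; lia.
Qed.

Lemma weight_eq0 C : is_orientation C -> ~~ [forall v : grid n,
    is_bulk n v.1 v.2 ==> (indeg C v == 2%N) && (outdeg C v == 2%N)] -> weight C = 0.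
Proof.
move=> oC /forallPn[v]; rewrite negb_imply => /andP[bv dv].
have /and3P[/andP[i0 iN] ij jN] := bv.
have W0 : W_bulk q C v.1 v.2 (u v.1 * col v.2) = 0.
  apply/eqP; apply: contraNT dv => /(bulk_degrees oC bv); rewrite vtx_val => -[-> ->].
  by rewrite !eqxx.
apply/eqP; rewrite /weight prodf_seq_eq0; apply/hasP; exists (v.1 : nat); first by rewrite mem_index_iota i0.
rewrite /= !mulf_eq0 prodf_seq_eq0 (_ : has _ _) ?orbT //; apply/hasP; exists (v.2 : nat).
  by rewrite mem_index_iota ij.
by rewrite /= W0.
Qed.

(** By [weight_eq0] the sum extends to all orientations with top edges up, that is, to all states of
    the remaining edges, which are then summed row by row. *)
Lemma Z_Zup : Z q n u = Zup q [seq u i | i <- iota 1 n] (u n.+1).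
Proof.
transitivity (\sum_(C | is_orientation C &&
    all (fun e => (edge_arc n e \in C) == true) top_edges) weight C).
  rewrite [RHS](bigID (@six_vertex n)) /= [X in _ + X]big1 ?addr0; last first.
    move=> C /andP[/andP[oC tC] sC]; apply: weight_eq0 => //; apply: contraNN sC => bC.
    by rewrite /six_vertex oC bC -top_edgesE andbT; exact: tC.
  apply: eq_bigl => C; rewrite -[_ && all _ _]/(all _ top_edges) top_edgesE.
  apply/idP/idP => [sC|/andP[]//]; rewrite sC andbT.
  by case/and3P: sC => -> ->.
rewrite (sum_orientations weight (fun=> true) uniq_edges mem_edges).
rewrite (@eq_sum_states _ _ _ (fun g => \prod_(i <- iota 1 n) row_weight i g)); last first.
  by move=> g _; apply: weight_orient.
have := sum_rows (fun=> true) (leqnn n); rewrite subSn // subnn => ->.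
rewrite /Zup size_map size_iota; congr (Zword _ _ _ _).
by apply: (@eq_from_nth _ true); rewrite ?size_map ?size_nseq size_iota // => i hi;
   rewrite (nth_map 0%N) ?size_iota // nth_nseq hi.
Qed.

End PartitionFunction.

(** * Indeterminates *)

Lemma generic_map (F : fieldType) (T : eqType) (x : T -> F) (s : seq T) :
  (forall i, x i != 0) -> (forall i j, x i ^+ 6 = x j ^+ 6 -> i = j) ->
  (forall i j, x i ^+ 6 != x j ^- 6) -> uniq s -> generic [seq x i | i <- s].
Proof.
move=> x0 xI xV; elim: s => //= i s IH /andP[si /IH/andP[s0 us]].
rewrite /generic /sixths /= x0 s0 us inE negb_or xV !andbT /=.
apply/andP; split; apply/negP => /flatten_mapP[_ /mapP[j js ->]]; rewrite !inE.
  case/orP => [/eqP/xI ij|]; last by rewrite (negPf (xV _ _)).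
  by move: si; rewrite ij js.
rewrite eq_sym (negPf (xV _ _)) /= (inj_eq (@invr_inj _)) => /eqP/xI ij.
by move: si; rewrite ij js.
Qed.

Section Indeterminates.
Variables (R : realType) (n : nat).

Lemma exp_ipi6_root : exp_ipi6 R ^+ 4 - exp_ipi6 R ^+ 2 + 1 = 0.
Proof.
set c := cos (pi / 6%:R : R); set s := sin (pi / 6%:R : R).
have cs : c ^+ 2 + s ^+ 2 = 1 by exact: cos2Dsin2.
have c0 : 0 < c.
  by rewrite cos_gt0_pihalf //; have := pi_gt0 R; lra.
have c2 : 4%:R * c ^+ 2 = 3%:R.
  (* Expanding cos(pi/2) = 0 as the cosine of three times pi/6 gives c (4 c^2 - 3) = 0. *)
  have e3 : pi / 2%:R = pi / 6%:R + (pi / 6%:R + pi / 6%:R) :> R by field.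
  have := cos_pihalf R; rewrite e3 cosD cosD sinD -/c -/s => h.
  apply: (mulfI (lt0r_neq0 c0)); nra.
have s2 : 4%:R * s ^+ 2 = 1 by lra.
have e2 : exp_ipi6 R ^+ 2 = (2%:R^-1 +i* (2%:R * c * s))%C.
  rewrite expr2 -[exp_ipi6 R]/(c +i* s)%C; simpc.
  by apply/eqP; rewrite eq_complex /=; apply/andP; split; apply/eqP; lra.
have t2 : (2%:R * c * s) ^+ 2 = 3%:R / 4%:R.
  have -> : (2%:R * c * s) ^+ 2 = (4%:R * c ^+ 2) * (4%:R * s ^+ 2) / 4%:R by field.
  by rewrite c2 s2 mulr1.
rewrite (exprM _ 2 2) e2; move: (2%:R * c * s) t2 => t t2; rewrite expr2 in t2.
rewrite expr2; simpc; apply/eqP; rewrite eq_complex /=.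
by apply/andP; split; apply/eqP; lra.
Qed.

Lemma constf_eq0 c : (constf n c == 0 :> ratfun R n) = (c == 0).
Proof. by rewrite /constf tofrac_eq0 mpolyC_eq0. Qed.

Lemma constf_nat k : constf n k%:R = k%:R :> ratfun R n.
Proof. by rewrite /constf !rmorph_nat. Qed.

Lemma constf_root : constf n (exp_ipi6 R) ^+ 4 - constf n (exp_ipi6 R) ^+ 2 + 1 = 0 :> ratfun R n.
Proof.
apply/eqP; rewrite /constf -!rmorphXn -rmorphB -[1](rmorph1 (@tofrac _)) -rmorphD.
by rewrite tofrac_eq0 -[1](rmorph1 (@mpolyC _ _)) -rmorphB -rmorphD mpolyC_eq0 exp_ipi6_root.
Qed.

Definition var (i : 'I_n.+1) : ratfun R n := tofrac ('X_i : {mpoly (R[i])%C[n.+1]}).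

Lemma var_neq0 i : var i != 0.
Proof.
rewrite /var tofrac_eq0; apply/eqP => /(congr1 (mcoeff U_(i))).
by rewrite mcoeffX eqxx mcoeff0 => /eqP; rewrite oner_eq0.
Qed.

Lemma var_inj i j : var i ^+ 6 = var j ^+ 6 -> i = j.
Proof.
move/eqP; rewrite /var -!rmorphXn tofrac_eq !mpolyXn => /eqP.
move/(congr1 (mcoeff (U_(i) *+ 6)%MM)); rewrite !mcoeffX eqxx.
case: eqP => [/mnmP/(_ i)|_ /eqP]; last by rewrite oner_eq0.
by rewrite !mulmnE !mnm1E eqxx; case: eqP.
Qed.

(** Otherwise the monomial X_i^6 X_j^6 would be 1. *)
Lemma var_inv i j : var i ^+ 6 != var j ^- 6.
Proof.
apply/eqP => h; have := congr1 (fun z => z * var j ^+ 6) h.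
rewrite mulVf ?expf_neq0 ?var_neq0 // => /eqP.
rewrite /var -!rmorphXn -rmorphM -[1](rmorph1 (@tofrac _)) tofrac_eq !mpolyXn -mpolyXD => /eqP.
move/(congr1 (mcoeff (U_(i) *+ 6 + U_(j) *+ 6)%MM)); rewrite mcoeffX eqxx mcoeff1.
case: eqP => [/mnmP/(_ i)|_ /eqP]; last by rewrite oner_eq0.
by rewrite mnmDE !mulmnE !mnm1E eqxx mnm0E.
Qed.

Lemma generic_var (s : seq 'I_n.+1) : uniq s -> generic [seq var i | i <- s].
Proof. by apply: generic_map => [i|i j|i j]; [exact: var_neq0|exact: var_inj|exact: var_inv]. Qed.

End Indeterminates.

(** * From generic parameters to the indeterminates *)

Lemma schurE (F : fieldType) n (u : nat -> F) w :
  schur (lambda n) (schur_args u w : 'I_n.*2.+1 -> F) =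
  schl n (rcons (sqs [seq u m | m <- iota 1 n]) w).
Proof.
have e (i : 'I_n.*2.+1) : schur_args u w i = (rcons (sqs [seq u m | m <- iota 1 n]) w)`_i.
  by rewrite /schur_args /sqs -map_comp.
rewrite /schl /snum /vdm size_rcons size_sqs size_map size_iota /schur /alt /alternant.
by congr (_ / _); congr (determinant _); apply/matrixP => i j; rewrite !mxE e.
Qed.

(** Genericity includes v itself, which makes v + 1 nonzero and keeps v^2 out of [sqs us]; the
    denominators of [schur_id] can then be restored. *)
Lemma Z_schur (F : fieldType) (q : F) (n : nat) (u : nat -> F) (v := u n.+1) :
  q ^+ 4 - q ^+ 2 + 1 = 0 -> 2%:R != 0 :> F -> 3%:R != 0 :> F ->
  generic (v :: [seq u i | i <- iota 1 n]) ->
  Z q n u = (3%:R ^+ tri n)^-1 *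
    (v ^+ n / (v + 1) * schur (lambda n) (schur_args u (v ^- 2) : 'I_n.*2.+1 -> F) +
     v ^- n / (v^-1 + 1) * schur (lambda n) (schur_args u (v ^+ 2) : 'I_n.*2.+1 -> F)).
Proof.
move=> q12 two0 three0 gvus; rewrite Z_Zup !schurE -/v.
set us := [seq u i | i <- iota 1 n] in gvus *.
have [v0 v6 v6us _ gus] := generic_cons gvus.
have v1 : v + 1 != 0.
  (* If v = -1, then v^6 = v^-6. *)
  apply: contraNneq v6 => /eqP; rewrite addr_eq0 => /eqP ->.
  by rewrite (exprM _ 2 3) sqrrN !expr1n invr1.
have vS : v ^+ 2 \notin sqs us by apply: contraNN v6us => /mem_sqs; rewrite -exprM.
have := schur_id_generic q12 two0 three0 gus v0 vS.
rewrite /schur_id /rhs size_map size_iota => e.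
have t0 : 3%:R ^+ tri n != 0 :> F by rewrite expf_neq0.
have vn0 : v ^+ n != 0 by rewrite expf_neq0.
apply: (mulfI (mulf_neq0 t0 v1)); rewrite e.
have v1' : v^-1 + 1 = (v + 1) / v by rewrite mulrDl divff // mul1r addrC.
rewrite v1'; move: (3%:R ^+ _) t0 (v ^+ n) vn0 => t t0 vn vn0.
by field; rewrite t0 vn0 v0 v1.
Qed.

Unset Implicit Arguments.

Theorem theorem3 (R : realType) (n : nat) :
  let u : nat -> ratfun R n := @indet R n in
  let v : ratfun R n := u n.+1 in
  Z (constf n (exp_ipi6 R)) n u =
  (3%:R ^+ (n * (n - 1) %/ 2))^-1 *
  (v ^+ n / (v + 1) *
     schur (lambda n) (schur_args u (v ^- 2) : 'I_n.*2.+1 -> ratfun R n) +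
   v ^- n / (v^-1 + 1) *
     schur (lambda n) (schur_args u (v ^+ 2) : 'I_n.*2.+1 -> ratfun R n)).
Proof.
have nat_neq0 k : k.+1%:R != 0 :> ratfun R n by rewrite -constf_nat constf_eq0 pnatr_eq0.
apply: Z_schur (constf_root R n) (nat_neq0 1%N) (nat_neq0 2%N) _.
rewrite (_ : _ :: _ = [seq var R i | i <- inord n :: [seq inord k.-1 | k <- iota 1 n]]); last first.
  by rewrite map_cons -map_comp.
apply: generic_var; rewrite cons_uniq; apply/andP; split.
  apply/mapP => -[k]; rewrite mem_iota => hk /(congr1 val); rewrite /= !inordK; lia.
rewrite map_inj_in_uniq ?iota_uniq // => i j; rewrite !mem_iota => hi hj /(congr1 val).
by rewrite /= !inordK; lia.
Qed.
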